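(* Let $\gamma:\mathbb R\to\mathcal S$ be the natural parameterization of a generic Legendrian curve with constant cr-curvature $\kappa\equiv c$. Then $\gamma$ is periodic (closed) if and only if $c=\mathtt c(q)$ for some rational number $q>1$. In that case, writing $q=m/n$ with $m,n$ relatively prime positive integers, $\gamma$ is cr-equivalent to $p_h^{-1}\circ\widetilde\gamma_q$, where $$\widetilde\gamma_q:t\in\mathbb R\mapsto R_{Oz}(mt/n)\,\eta_{\mathtt r(q)}(t)\in\mathbb R^3,$$ $R_{Oz}(\theta)$ is the rotation of angle $\theta$ about the $z$-axis of $\mathbb R^3$, and $\widetilde\gamma_q$ is a torus knot of type $(-m,n)$.
   Context: $\mathbb C^{2,1}$ is $\mathbb C^3$ with $\langle z,w\rangle=i(\bar z^1w^3-\bar z^3w^1)+\bar z^2w^2$; $\mathcal S=\{[z]\in\mathbb{CP}^2:\langle z,z\rangle=0\}$ with contact distribution $\ker\zeta$, $\zeta=-\frac{i}{\bar z^tz}\langle z,dz\rangle|_{T\mathcal S}$; Legendrian curves are immersions tangent to it. $G\cong SU(2,1)$ is the group of unimodular matrices preserving $\langle\cdot,\cdot\rangle$, acting by $A\cdot[z]=[Az]$. For a normalized lift $\Gamma$ of $\gamma$ (i.e. $\gamma=[\Gamma]$, $\det(\Gamma,\Gamma',\Gamma'')=i$) set $a=\mathrm{Im}\langle\Gamma''',\Gamma''\rangle$, $b=\frac12\langle\Gamma'',\Gamma''\rangle$. $\gamma$ is generic if $a$ never vanishes; it is a natural parameterization if $a\equiv1$ (every generic curve admits one, unique up to translation of the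 parameter, after possibly reversing orientation); then $\kappa:=b$ is the cr-curvature. Two curves $\gamma,\widetilde\gamma$ are cr-equivalent if $\widetilde\gamma=A\cdot(\gamma\circ h)$ for some $A\in G$ and some change of parameter $h$. The Heisenberg projection is $p_h:[z]\in\mathcal S\setminus\{[0:0:1]\}\mapsto(\mathrm{Re}(z^2/z^1),\mathrm{Im}(z^2/z^1),\mathrm{Re}(z^3/z^1))\in\mathbb R^3$. For $q>1$, $\mathtt r(q)=\sqrt{2+4q-4\sqrt{q(1+q)}}$ and $$\mathtt c(q)=\frac{3(16+56\mathtt r^4+\mathtt r^8)}{2\big(2(-64+528\mathtt r^4+132\mathtt r^8-\mathtt r^{12})\big)^{2/3}},\quad \mathtt r=\mathtt r(q);$$ $\mathtt c:(1,\infty)\to(\frac{3}{2\sqrt[3]4},\infty)$ is a diffeomorphism. For $r>0$, $\eta_r(\theta)=(x_r,y_r,z_r)(\theta)$ with $D=4+r^4+(4-r^4)\cos\theta$, $x_r=2r\frac{2+r^2+(2-r^2)\cos\theta}{D}$, $y_r=-\frac{2r(r^2-2)\sin\theta}{D}$, $z_r=\frac{(r^4-4)\sin\theta}{D}$. *)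

(* Defs.v *)
From Stdlib Require Import Reals Lra QArith Qreals.
Open Scope R_scope.

Record C := mkC { re : R ; im : R }.
Definition C0 : C := mkC 0 0.
Definition C1 : C := mkC 1 0.
Definition Ci : C := mkC 0 1.
Definition RtoC (x : R) : C := mkC x 0.
Definition Cadd (z w : C) : C := mkC (re z + re w) (im z + im w).
Definition Copp (z : C) : C := mkC (- re z) (- im z).
Definition Csub (z w : C) : C := Cadd z (Copp w).
Definition Cmul (z w : C) : C :=
  mkC (re z * re w - im z * im w) (re z * im w + im z * re w).
Definition Cconj (z : C) : C := mkC (re z) (- im z).
Definition Cinv (z : C) : C :=
  mkC (re z / (re z ^ 2 + im z ^ 2)) (- im z / (re z ^ 2 + im z ^ 2)).
Definition Cdiv (z w : C) : C := Cmul z (Cinv w).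

Record C3 := mkC3 { z1 : C ; z2 : C ; z3 : C }.
Definition C3zero : C3 := mkC3 C0 C0 C0.
Definition C3scale (l : C) (z : C3) : C3 :=
  mkC3 (Cmul l (z1 z)) (Cmul l (z2 z)) (Cmul l (z3 z)).

Definition herm (z w : C3) : C :=
  Cadd (Cmul Ci (Csub (Cmul (Cconj (z1 z)) (z3 w)) (Cmul (Cconj (z3 z)) (z1 w))))
       (Cmul (Cconj (z2 z)) (z2 w)).

Definition det3 (u v w : C3) : C :=
  Cadd (Csub (Cmul (z1 u) (Csub (Cmul (z2 v) (z3 w)) (Cmul (z3 v) (z2 w))))
             (Cmul (z2 u) (Csub (Cmul (z1 v) (z3 w)) (Cmul (z3 v) (z1 w)))))
       (Cmul (z3 u) (Csub (Cmul (z1 v) (z2 w)) (Cmul (z2 v) (z1 w)))).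

Definition proj_eq (z w : C3) : Prop :=
  z <> C3zero /\ exists l : C, l <> C0 /\ w = C3scale l z.

(* a 3x3 complex matrix, entries A i j for i, j in {0,1,2} *)
Definition Mat := nat -> nat -> C.
Definition col (A : Mat) (j : nat) : C3 := mkC3 (A 0%nat j) (A 1%nat j) (A 2%nat j).
Definition matvec (A : Mat) (z : C3) : C3 :=
  mkC3 (Cadd (Cadd (Cmul (A 0%nat 0%nat) (z1 z)) (Cmul (A 0%nat 1%nat) (z2 z))) (Cmul (A 0%nat 2%nat) (z3 z)))
       (Cadd (Cadd (Cmul (A 1%nat 0%nat) (z1 z)) (Cmul (A 1%nat 1%nat) (z2 z))) (Cmul (A 1%nat 2%nat) (z3 z)))
       (Cadd (Cadd (Cmul (A 2%nat 0%nat) (z1 z)) (Cmul (A 2%nat 1%nat) (z2 z))) (Cmul (A 2%nat 2%nat) (z3 z))).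
Definition matdet (A : Mat) : C := det3 (col A 0) (col A 1) (col A 2).
Definition inG (A : Mat) : Prop :=
  matdet A = C1 /\ forall z w : C3, herm (matvec A z) (matvec A w) = herm z w.

(* D k is the k-th derivative of D 0 (componentwise, real and imaginary parts) *)
Definition C_deriv (f f' : R -> C) : Prop :=
  forall t, derivable_pt_lim (fun s => re (f s)) t (re (f' t)) /\
            derivable_pt_lim (fun s => im (f s)) t (im (f' t)).
Definition C3_deriv (F F' : R -> C3) : Prop :=
  C_deriv (fun s => z1 (F s)) (fun s => z1 (F' s)) /\
  C_deriv (fun s => z2 (F s)) (fun s => z2 (F' s)) /\
  C_deriv (fun s => z3 (F s)) (fun s => z3 (F' s)).
Definition smooth3 (D : nat -> R -> C3) : Prop := forall k, C3_deriv (D k) (D (S k)).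
Definition smoothR (D : nat -> R -> R) : Prop :=
  forall k t, derivable_pt_lim (D k) t (D (S k) t).

Definition diffeoR (h : R -> R) : Prop :=
  exists D : nat -> R -> R, smoothR D /\ D 0%nat = h /\
    (forall t, D 1%nat t <> 0) /\ (forall s, exists! t, h t = s).

(* cr-equivalence of curves given by representatives in C^3 \ {0}:
   gt = A . (g o h) pointwise in CP^2 *)
Definition cr_equiv (g gt : R -> C3) : Prop :=
  exists (A : Mat) (h : R -> R), inG A /\ diffeoR h /\
    forall t, proj_eq (gt t) (matvec A (g (h t))).

Definition periodic_curve (g : R -> C3) : Prop :=
  exists T, 0 < T /\ forall t, proj_eq (g (t + T)) (g t).

Record R3 := mkR3 { px : R ; py : R ; pz : R }.
Definition e3 : C3 := mkC3 C0 C0 C1.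
Definition p_h (z : C3) : R3 :=
  mkR3 (re (Cdiv (z2 z) (z1 z))) (im (Cdiv (z2 z) (z1 z))) (re (Cdiv (z3 z) (z1 z))).
Definition p_h_inv (p : R3) : C3 :=
  mkC3 C1 (mkC (px p) (py p)) (mkC (pz p) ((px p ^ 2 + py p ^ 2) / 2)).

Lemma p_h_inv_in_S p : herm (p_h_inv p) (p_h_inv p) = C0.
Proof.
  destruct p as [x y u]; unfold herm, p_h_inv; simpl.
  unfold Cadd, Cmul, Csub, Copp, Cconj, Ci, C1, C0; simpl. f_equal; field.
Qed.
Lemma p_h_inv_not_e3 p : ~ proj_eq (p_h_inv p) e3.
Proof.
  intros [_ [l [Hl H]]].
  pose proof (f_equal (fun z => re (z1 z)) H) as Ha.
  pose proof (f_equal (fun z => im (z1 z)) H) as Hb.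
  destruct l as [a b]. unfold e3, C3scale, p_h_inv, Cmul, C0, C1 in *; simpl in *.
  apply Hl. f_equal; lra.
Qed.
Lemma p_h_p_h_inv p : p_h (p_h_inv p) = p.
Proof.
  destruct p as [x y u]; unfold p_h, p_h_inv, Cdiv, Cinv, Cmul, C1; simpl.
  f_equal; field.
Qed.

Definition rotz (th : R) (p : R3) : R3 :=
  mkR3 (px p * cos th - py p * sin th) (px p * sin th + py p * cos th) (pz p).

Definition rfun (q : R) : R := sqrt (2 + 4 * q - 4 * sqrt (q * (1 + q))).
(* X^(2/3) for real X read as (cube root of X)^2 = |X|^(2/3) *)
Definition pow23 (X : R) : R := Rpower (Rabs X) (2 / 3).
Definition cfun (q : R) : R :=
  let r := rfun q in
  3 * (16 + 56 * r ^ 4 + r ^ 8) /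
  (2 * pow23 (2 * (-64 + 528 * r ^ 4 + 132 * r ^ 8 - r ^ 12))).

Definition eta (r th : R) : R3 :=
  let D := 4 + r ^ 4 + (4 - r ^ 4) * cos th in
  mkR3 (2 * r * (2 + r ^ 2 + (2 - r ^ 2) * cos th) / D)
       (- (2 * r * (r ^ 2 - 2) * sin th) / D)
       ((r ^ 4 - 4) * sin th / D).

Definition gtilde (q t : R) : R3 := rotz (q * t) (eta (rfun q) t).

Definition dist3 (a b : R3) : R :=
  sqrt ((px a - px b) ^ 2 + (py a - py b) ^ 2 + (pz a - pz b) ^ 2).
Definition cont3 (f : R3 -> R3) : Prop :=
  forall x eps, 0 < eps -> exists del, 0 < del /\
    forall y, dist3 x y < del -> dist3 (f x) (f y) < eps.
Definition homeo3 (f : R3 -> R3) : Prop :=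
  exists g, (forall x, g (f x) = x) /\ (forall y, f (g y) = y) /\ cont3 f /\ cont3 g.
Definition ambient_isotopic (K1 K2 : R3 -> Prop) : Prop :=
  exists H : R -> R3 -> R3,
    (forall s x eps, 0 <= s <= 1 -> 0 < eps -> exists del, 0 < del /\
       forall s' y, 0 <= s' <= 1 -> Rabs (s - s') < del -> dist3 x y < del ->
         dist3 (H s x) (H s' y) < eps) /\
    (forall s, 0 <= s <= 1 -> homeo3 (H s)) /\
    (forall x, H 0 x = x) /\
    (forall y, K2 y <-> exists x, K1 x /\ H 1 x = y).
Definition image (g : R -> R3) : R3 -> Prop := fun y => exists t, g t = y.
Definition cont_curve (g : R -> R3) : Prop :=
  forall t, continuity_pt (fun s => px (g s)) t /\
            continuity_pt (fun s => py (g s)) t /\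
            continuity_pt (fun s => pz (g s)) t.
Definition simple_closed (g : R -> R3) : Prop :=
  cont_curve g /\ exists L, 0 < L /\ (forall t, g (t + L) = g t) /\
    forall s t, 0 <= s < L -> 0 <= t < L -> g s = g t -> s = t.
(* standard (p,q) torus knot (Wikipedia convention):
   ((2 + cos q phi) cos p phi, (2 + cos q phi) sin p phi, - sin q phi) *)
Definition std_torus_knot (p q : Z) (phi : R) : R3 :=
  let rr := cos (IZR q * phi) + 2 in
  mkR3 (rr * cos (IZR p * phi)) (rr * sin (IZR p * phi)) (- sin (IZR q * phi)).
Definition torus_knot_of_type (g : R -> R3) (p q : Z) : Prop :=
  simple_closed g /\ ambient_isotopic (image g) (image (std_torus_knot p q)).

(* Main.v *)
From Stdlib Require Import Reals ZArith QArith Qreals Lra Lia Psatz.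
Require Import Defs.
Open Scope R_scope.

(** Differentiating the normalization shows that [(Gamma, Gamma', Gamma'')] has a constant Gram
    matrix and that [Gamma''' = i Gamma - 2 c Gamma'], whose characteristic roots are [i mu] with
    [mu^3 - 2 c mu + 1 = 0].  If the [mu] are not three distinct reals, the squared norm of
    [Gamma' - i mu1 Gamma], for the negative root [mu1], is convex and not affine, which excludes
    periodicity.  Otherwise [mu1 < 0 < mu2 < mu3] and [Gamma] is a sum of three
    exponentials; it closes up iff [q = (mu2 - mu1) / (mu3 - mu2) > 1] is rational, and Vieta's
    formulas give [c = c(q)].  Up to a scalar factor, [p_h^-1 o gtilde_q] is also a sum of three
    exponentials, with frequencies proportional to the [mu] up to a shift, hence has a normalized
    lift with the same Gram matrix and equation: the linear map between the two frames at one
    point is the required element of [G].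

    In cylindrical coordinates, [gtilde_q] has angle [q t + psi(t)], while [(rho^2, z)] runs over
    an ellipse with eccentric angle [t - 2 psi(t)], where [psi] is a continuous function of
    [(rho, z)].  A twist around the axis followed by a radial and a vertical rescaling carries it
    to the standard torus knot, and each of these maps is joined to the identity explicitly. *)

(** * Complex vectors, the Hermitian form and the structure equations *)

Lemma C_eq (z w : C) : re z = re w -> im z = im w -> z = w.
Proof. destruct z, w; simpl; intros -> ->; reflexivity. Qed.

Ltac Ccomp := apply C_eq; simpl.

Lemma C_ring : ring_theory C0 C1 Cadd Cmul Csub Copp (@eq C).
Proof. constructor; intros; Ccomp; ring. Qed.
Add Ring Cring : C_ring.

Lemma Ci_sq : Cmul Ci Ci = Copp C1.
Proof. Ccomp; ring. Qed.

Lemma C3_eq (u v : C3) : z1 u = z1 v -> z2 u = z2 v -> z3 u = z3 v -> u = v.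
Proof. destruct u, v; simpl; intros -> -> ->; reflexivity. Qed.

Lemma conj_add z w : Cconj (Cadd z w) = Cadd (Cconj z) (Cconj w).
Proof. Ccomp; ring. Qed.
Lemma conj_sub z w : Cconj (Csub z w) = Csub (Cconj z) (Cconj w).
Proof. Ccomp; ring. Qed.
Lemma conj_mul z w : Cconj (Cmul z w) = Cmul (Cconj z) (Cconj w).
Proof. Ccomp; ring. Qed.
Lemma conj_conj z : Cconj (Cconj z) = z.
Proof. Ccomp; ring. Qed.
Lemma conj_Ci : Cconj Ci = Copp Ci.
Proof. Ccomp; ring. Qed.
Lemma conj_RtoC x : Cconj (RtoC x) = RtoC x.
Proof. Ccomp; ring. Qed.

Lemma Cmul_integral z w : Cmul z w = C0 -> z = C0 \/ w = C0.
Proof.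
  intros H.
  pose proof (f_equal re H) as Hr. pose proof (f_equal im H) as Hi. simpl in Hr, Hi.
  destruct (Req_dec (re w ^ 2 + im w ^ 2) 0) as [E|E].
  - right. Ccomp; nra.
  - left. Ccomp.
    + assert (re z * (re w ^ 2 + im w ^ 2) = 0) as X.
      { replace (re z * _) with ((re z * re w - im z * im w) * re w
          + (re z * im w + im z * re w) * im w) by ring. rewrite Hr, Hi; ring. }
      apply Rmult_integral in X; tauto.
    + assert (im z * (re w ^ 2 + im w ^ 2) = 0) as X.
      { replace (im z * _) with ((re z * im w + im z * re w) * re w
          - (re z * re w - im z * im w) * im w) by ring. rewrite Hr, Hi; ring. }
      apply Rmult_integral in X; tauto.
Qed.

Lemma Cmul_cancel_l a z w : a <> C0 -> Cmul a z = Cmul a w -> z = w.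
Proof.
  intros Ha H. assert (Cmul a (Csub z w) = C0) as X.
  { replace (Cmul a (Csub z w)) with (Csub (Cmul a z) (Cmul a w)) by ring. rewrite H; ring. }
  apply Cmul_integral in X as [X|X]; [contradiction|].
  replace z with (Cadd (Csub z w) w) by ring. rewrite X; ring.
Qed.

Lemma Ci_neq0 : Ci <> C0.
Proof. intros H. apply (f_equal im) in H; simpl in H; lra. Qed.
Lemma RtoC_neq0 x : x <> 0 -> RtoC x <> C0.
Proof. intros Hx H. apply (f_equal re) in H; simpl in H; lra. Qed.

Definition Cnorm2 (z : C) : R := re z ^ 2 + im z ^ 2.
Lemma Cnorm2_eq0 z : Cnorm2 z = 0 -> z = C0.
Proof. destruct z as [x y]. unfold Cnorm2; simpl; intros H. Ccomp; nra. Qed.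
Lemma conj_mul_self z : Cmul (Cconj z) z = RtoC (Cnorm2 z).
Proof. unfold Cnorm2; Ccomp; ring. Qed.

Definition C3add (u v : C3) : C3 :=
  mkC3 (Cadd (z1 u) (z1 v)) (Cadd (z2 u) (z2 v)) (Cadd (z3 u) (z3 v)).

Lemma herm_addr u v w : herm u (C3add v w) = Cadd (herm u v) (herm u w).
Proof. unfold herm; simpl; ring. Qed.
Lemma herm_scaler u a v : herm u (C3scale a v) = Cmul a (herm u v).
Proof. unfold herm; simpl; ring. Qed.
Lemma herm_conj u v : herm v u = Cconj (herm u v).
Proof.
  unfold herm. rewrite !conj_add, !conj_mul, !conj_sub, !conj_mul, !conj_conj, conj_Ci. ring.
Qed.
Lemma herm_addl u v w : herm (C3add v w) u = Cadd (herm v u) (herm w u).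
Proof. rewrite herm_conj, herm_addr, conj_add, <- !herm_conj; ring. Qed.
Lemma herm_scalel u a v : herm (C3scale a v) u = Cmul (Cconj a) (herm v u).
Proof. rewrite herm_conj, herm_scaler, conj_mul, <- !herm_conj; ring. Qed.
Lemma im_herm_self u : im (herm u u) = 0.
Proof. unfold herm; simpl; ring. Qed.

(** With P the matrix of columns [a], [b], [c], the Gram matrix is the adjoint of P times H times P,
    where H is the matrix of the form; the minus sign is the determinant of H. *)
Lemma gram_det (a b c : C3) :
  Cadd (Csub (Cmul (herm a a) (Csub (Cmul (herm b b) (herm c c)) (Cmul (herm b c) (herm c b))))
             (Cmul (herm a b) (Csub (Cmul (herm b a) (herm c c)) (Cmul (herm b c) (herm c a)))))
       (Cmul (herm a c) (Csub (Cmul (herm b a) (herm c b)) (Cmul (herm b b) (herm c a))))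
  = Copp (Cmul (Cconj (det3 a b c)) (det3 a b c)).
Proof.
  unfold det3. repeat rewrite ?conj_add, ?conj_sub, ?conj_mul. unfold herm.
  ring [Ci_sq].
Qed.

Lemma cramer (a b c z : C3) :
  C3scale (det3 a b c) z =
  C3add (C3scale (det3 z b c) a) (C3add (C3scale (det3 a z c) b) (C3scale (det3 a b z) c)).
Proof. apply C3_eq; unfold det3; simpl; ring. Qed.

(** * Calculus of complex-valued and vector-valued curves *)

Lemma C_deriv_add f f' g g' : C_deriv f f' -> C_deriv g g' ->
  C_deriv (fun t => Cadd (f t) (g t)) (fun t => Cadd (f' t) (g' t)).
Proof.
  intros Hf Hg t. destruct (Hf t), (Hg t). split; simpl;
  apply derivable_pt_lim_plus; assumption.
Qed.
Lemma C_deriv_sub f f' g g' : C_deriv f f' -> C_deriv g g' ->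
  C_deriv (fun t => Csub (f t) (g t)) (fun t => Csub (f' t) (g' t)).
Proof.
  intros Hf Hg t. destruct (Hf t), (Hg t). split; simpl;
  apply derivable_pt_lim_plus; try assumption; apply derivable_pt_lim_opp; assumption.
Qed.
Lemma C_deriv_conj f f' : C_deriv f f' ->
  C_deriv (fun t => Cconj (f t)) (fun t => Cconj (f' t)).
Proof.
  intros Hf t. destruct (Hf t). split; simpl; [assumption|].
  apply derivable_pt_lim_opp; assumption.
Qed.
Lemma derivable_pt_lim_ext f g t l : (forall s, f s = g s) ->
  derivable_pt_lim f t l -> derivable_pt_lim g t l.
Proof.
  intros E H eps He. destruct (H eps He) as [d Hd]. exists d. intros h. rewrite <- !E. apply Hd.
Qed.
Lemma C_deriv_mul f f' g g' : C_deriv f f' -> C_deriv g g' ->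
  C_deriv (fun t => Cmul (f t) (g t))
          (fun t => Cadd (Cmul (f' t) (g t)) (Cmul (f t) (g' t))).
Proof.
  intros Hf Hg t. destruct (Hf t) as [fr fi], (Hg t) as [gr gi]. split; simpl.
  - pose proof (derivable_pt_lim_minus _ _ _ _ _ (derivable_pt_lim_mult _ _ _ _ _ fr gr)
      (derivable_pt_lim_mult _ _ _ _ _ fi gi)) as X. cbv beta in X.
    match type of X with derivable_pt_lim _ _ ?l =>
      match goal with |- derivable_pt_lim _ _ ?l' => replace l' with l by ring end end.
    exact X.
  - pose proof (derivable_pt_lim_plus _ _ _ _ _ (derivable_pt_lim_mult _ _ _ _ _ fr gi)
      (derivable_pt_lim_mult _ _ _ _ _ fi gr)) as X. cbv beta in X.
    match type of X with derivable_pt_lim _ _ ?l =>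
      match goal with |- derivable_pt_lim _ _ ?l' => replace l' with l by ring end end.
    exact X.
Qed.
Lemma C_deriv_const a : C_deriv (fun _ => a) (fun _ => C0).
Proof. intros t; split; simpl; apply derivable_pt_lim_const. Qed.
Lemma C_deriv_ext f g f' g' : (forall t, f t = g t) -> (forall t, f' t = g' t) ->
  C_deriv f f' -> C_deriv g g'.
Proof.
  intros E E' H t. destruct (H t) as [a b]. rewrite E' in a, b.
  split; [apply (derivable_pt_lim_ext (fun s => re (f s)))
         |apply (derivable_pt_lim_ext (fun s => im (f s)))]; auto; intros; rewrite E; auto.
Qed.
Lemma C_deriv_scal a f f' : C_deriv f f' ->
  C_deriv (fun t => Cmul a (f t)) (fun t => Cmul a (f' t)).
Proof.
  intros H. eapply C_deriv_ext; [reflexivity| |apply (C_deriv_mul _ _ _ _ (C_deriv_const a) H)].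
  intros; cbv beta; ring.
Qed.
Lemma C_deriv_unique f f' g g' : (forall t, f t = g t) ->
  C_deriv f f' -> C_deriv g g' -> forall t, f' t = g' t.
Proof.
  intros E Hf Hg t.
  destruct (C_deriv_ext f g f' f' E (fun _ => eq_refl) Hf t) as [a b], (Hg t) as [c d].
  apply C_eq; eapply uniqueness_limite; eassumption.
Qed.
Lemma C_deriv_of_const f f' a : (forall t, f t = a) -> C_deriv f f' -> forall t, f' t = C0.
Proof. intros E H. apply (C_deriv_unique f f' (fun _ => a) (fun _ => C0) E H (C_deriv_const a)). Qed.

Lemma C_deriv_zero f : C_deriv f (fun _ => C0) -> forall t, f t = f 0.
Proof.
  intros H t.
  assert (forall g : R -> R, (forall s, derivable_pt_lim g s 0) -> g t = g 0) as K.
  { intros g Hg. set (pr := fun s => exist _ 0 (Hg s) : derivable_pt g s).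
    exact (null_derivative_1 g pr (fun s => eq_refl) t 0). }
  apply C_eq; [apply (K (fun s => re (f s))) | apply (K (fun s => im (f s)))]; intros s; apply H.
Qed.

Lemma C_deriv_shift f f' T : C_deriv f f' -> C_deriv (fun t => f (t + T)) (fun t => f' (t + T)).
Proof.
  intros H t. destruct (H (t + T)) as [a b].
  assert (forall g l, derivable_pt_lim g (t + T) l ->
    derivable_pt_lim (fun s => g (s + T)) t l) as K.
  { intros g l Hg eps He. destruct (Hg eps He) as [d Hd]. exists d. intros h Hh Hh'.
    replace (t + h + T) with (t + T + h) by ring. apply Hd; assumption. }
  split; [apply (K (fun s => re (f s))) | apply (K (fun s => im (f s)))]; assumption.
Qed.

Lemma C3_deriv_shift F F' T : C3_deriv F F' ->
  C3_deriv (fun t => F (t + T)) (fun t => F' (t + T)).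
Proof.
  intros (a & b & d). repeat split;
  first [apply (C_deriv_shift _ _ T a) | apply (C_deriv_shift _ _ T b) | apply (C_deriv_shift _ _ T d)].
Qed.

Lemma herm_deriv F F' G G' : C3_deriv F F' -> C3_deriv G G' ->
  C_deriv (fun t => herm (F t) (G t)) (fun t => Cadd (herm (F' t) (G t)) (herm (F t) (G' t))).
Proof.
  intros (a & b & d) (a' & b' & d').
  eapply C_deriv_ext; [reflexivity| |].
  2:{ unfold herm. apply C_deriv_add; [apply C_deriv_scal, C_deriv_sub|]; apply C_deriv_mul;
      try eassumption; apply C_deriv_conj; eassumption. }
  intros t; unfold herm; cbv beta; ring.
Qed.

Lemma det3_deriv F F' G G' K K' : C3_deriv F F' -> C3_deriv G G' -> C3_deriv K K' ->
  C_deriv (fun t => det3 (F t) (G t) (K t))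
    (fun t => Cadd (det3 (F' t) (G t) (K t))
                (Cadd (det3 (F t) (G' t) (K t)) (det3 (F t) (G t) (K' t)))).
Proof.
  intros (a & b & d) (a' & b' & d') (a'' & b'' & d'').
  eapply C_deriv_ext; [reflexivity| |].
  2:{ unfold det3. apply C_deriv_add; [apply C_deriv_sub|];
      (apply C_deriv_mul; [eassumption|apply C_deriv_sub; apply C_deriv_mul; eassumption]). }
  intros t; unfold det3; cbv beta; ring.
Qed.

(** The Gram matrix and determinant that [(Gamma, Gamma', Gamma'')] has at every parameter. Two
    frames with the same [c] differ by an element of [G]. *)
Record frame (c : R) (g0 g1 g2 : C3) : Prop := mkframe {
  f00 : herm g0 g0 = C0; f01 : herm g0 g1 = C0; f02 : herm g0 g2 = Copp C1;
  f11 : herm g1 g1 = C1; f12 : herm g1 g2 = C0; f22 : herm g2 g2 = RtoC (2 * c);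
  fdet : det3 g0 g1 g2 = Ci }.

(** The hypotheses of the theorem in one bundle; [nl_legendrian] is tangency to the contact
    distribution. *)
Record natural_lift (Gam : nat -> R -> C3) (c : R) : Prop := mknatural_lift {
  nl_smooth : smooth3 Gam;
  nl_null : forall t, herm (Gam 0%nat t) (Gam 0%nat t) = C0;
  nl_legendrian : forall t, herm (Gam 0%nat t) (Gam 1%nat t) = C0;
  nl_det : forall t, det3 (Gam 0%nat t) (Gam 1%nat t) (Gam 2%nat t) = Ci;
  nl_natural : forall t, im (herm (Gam 3%nat t) (Gam 2%nat t)) = 1;
  nl_curvature :
    forall t, Cmul (RtoC (1 / 2)) (herm (Gam 2%nat t) (Gam 2%nat t)) = RtoC c }.

(** Let [p] be this real number. Differentiating the contact condition gives
    [<Gamma, Gamma''> = - p], and then [gram_det] with determinant [i] reads [p^3 = 1]. *)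
Lemma lift_herm11 {Gam c} (N : natural_lift Gam c) t : herm (Gam 1%nat t) (Gam 1%nat t) = C1.
Proof.
  pose proof N as [Hs H00 H01 Hdet Ha Hb].
  pose proof (C_deriv_of_const _ _ _ H01 (herm_deriv _ _ _ _ (Hs 0%nat) (Hs 1%nat)) t) as E.
  cbv beta in E.
  pose proof (gram_det (Gam 0%nat t) (Gam 1%nat t) (Gam 2%nat t)) as G.
  rewrite Hdet, H00, H01, (herm_conj (Gam 0%nat t) (Gam 1%nat t)), H01,
    (herm_conj (Gam 0%nat t) (Gam 2%nat t)) in G.
  set (p := herm (Gam 1%nat t) (Gam 1%nat t)) in *.
  set (h := herm (Gam 0%nat t) (Gam 2%nat t)) in *.
  pose proof (im_herm_self (Gam 1%nat t)) as Ip. fold p in Ip. clearbody p h.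
  assert (h = Copp p) as Eh.
  { replace h with (Csub (Cadd p h) p) by ring. rewrite E; ring. }
  rewrite Eh in G. apply (f_equal re) in G. simpl in G. rewrite Ip in G.
  apply C_eq; simpl; [|exact Ip].
  assert ((re p - 1) * (re p ^ 2 + re p + 1) = 0) as F by (ring_simplify in G; ring_simplify; lra).
  apply Rmult_integral in F as [F|F]; nra.
Qed.

Lemma lift_herm02 {Gam c} (N : natural_lift Gam c) t : herm (Gam 0%nat t) (Gam 2%nat t) = Copp C1.
Proof.
  pose proof N as [Hs H00 H01 Hdet Ha Hb].
  pose proof (C_deriv_of_const _ _ _ H01 (herm_deriv _ _ _ _ (Hs 0%nat) (Hs 1%nat)) t) as E.
  cbv beta in E. rewrite (lift_herm11 N) in E.
  replace (herm _ _) with (Csub (Cadd C1 (herm (Gam 0%nat t) (Gam 2%nat t))) C1) by ring.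
  rewrite E; ring.
Qed.

Lemma lift_herm22 {Gam c} (N : natural_lift Gam c) t :
  herm (Gam 2%nat t) (Gam 2%nat t) = RtoC (2 * c).
Proof.
  pose proof N as [Hs H00 H01 Hdet Ha Hb].
  specialize (Hb t). pose proof (f_equal re Hb) as A; pose proof (f_equal im Hb) as B.
  revert A B. generalize (herm (Gam 2%nat t) (Gam 2%nat t)). intros z A B.
  simpl in A, B. Ccomp; lra.
Qed.

(** The derivative of the constant determinant is [det (Gamma, Gamma', Gamma''')]. Its vanishing
    removes the [Gamma''] term from Cramer's rule. *)
Lemma lift_comb3 {Gam c} (N : natural_lift Gam c) t : exists X Y,
  C3scale Ci (Gam 3%nat t) = C3add (C3scale X (Gam 0%nat t)) (C3scale Y (Gam 1%nat t)).
Proof.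
  pose proof N as [Hs H00 H01 Hdet Ha Hb].
  pose proof (C_deriv_of_const _ _ _ Hdet (det3_deriv _ _ _ _ _ _ (Hs 0%nat) (Hs 1%nat) (Hs 2%nat)) t) as E.
  cbv beta in E.
  pose proof (cramer (Gam 0%nat t) (Gam 1%nat t) (Gam 2%nat t) (Gam 3%nat t)) as K.
  rewrite Hdet in K.
  assert (det3 (Gam 0%nat t) (Gam 1%nat t) (Gam 3%nat t) = C0) as Z.
  { rewrite <- E. unfold det3; ring. }
  rewrite Z in K.
  exists (det3 (Gam 3%nat t) (Gam 1%nat t) (Gam 2%nat t)),
    (det3 (Gam 0%nat t) (Gam 3%nat t) (Gam 2%nat t)).
  rewrite K.
  apply C3_eq; simpl; ring.
Qed.

(** [Gamma'''] lies in the span of [Gamma] and [Gamma'], both orthogonal to [Gamma], so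
    differentiating [<Gamma, Gamma''> = -1] leaves only this product. *)
Lemma lift_herm12 {Gam c} (N : natural_lift Gam c) t : herm (Gam 1%nat t) (Gam 2%nat t) = C0.
Proof.
  pose proof N as [Hs H00 H01 Hdet Ha Hb].
  destruct (lift_comb3 N t) as (X & Y & K).
  pose proof (f_equal (herm (Gam 0%nat t)) K) as A.
  rewrite herm_addr, !herm_scaler, H00, H01 in A.
  assert (herm (Gam 0%nat t) (Gam 3%nat t) = C0) as B.
  { apply (Cmul_cancel_l Ci); [exact Ci_neq0|]. rewrite A; ring. }
  pose proof (C_deriv_of_const _ _ _ (lift_herm02 N) (herm_deriv _ _ _ _ (Hs 0%nat) (Hs 2%nat)) t) as E.
  cbv beta in E. rewrite B in E. rewrite <- E; ring.
Qed.

Lemma lift_frame {Gam c} (N : natural_lift Gam c) t :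
  frame c (Gam 0%nat t) (Gam 1%nat t) (Gam 2%nat t).
Proof.
  pose proof N as [Hs H00 H01 Hdet Ha Hb].
  constructor; auto; eauto using lift_herm02, lift_herm11, lift_herm12, lift_herm22.
Qed.

(** The two coefficients left by [lift_comb3] are found by pairing with [Gamma'] and [Gamma''].
    Constancy of the Gram matrix supplies [<Gamma', Gamma'''>] and the real part of
    [<Gamma'', Gamma'''>]; the natural parameterization supplies its imaginary part. *)
Lemma lift_ode {Gam c} (N : natural_lift Gam c) t : Gam 3%nat t =
  C3add (C3scale Ci (Gam 0%nat t)) (C3scale (RtoC (- 2 * c)) (Gam 1%nat t)).
Proof.
  pose proof N as [Hs H00 H01 Hdet Ha Hb].
  destruct (lift_comb3 N t) as (X & Y & K).
  pose proof (C_deriv_of_const _ _ _ (lift_herm12 N) (herm_deriv _ _ _ _ (Hs 1%nat) (Hs 2%nat)) t) as E1.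
  pose proof (C_deriv_of_const _ _ _ (lift_herm22 N) (herm_deriv _ _ _ _ (Hs 2%nat) (Hs 2%nat)) t) as E2.
  cbv beta in E1, E2. rewrite (lift_herm22 N) in E1.
  pose proof (f_equal (herm (Gam 1%nat t)) K) as A1.
  pose proof (f_equal (herm (Gam 2%nat t)) K) as A2.
  rewrite herm_addr, !herm_scaler in A1, A2.
  rewrite (herm_conj (Gam 0%nat t)), H01, (lift_herm11 N) in A1.
  rewrite (herm_conj (Gam 0%nat t)), (lift_herm02 N), (herm_conj (Gam 1%nat t)), (lift_herm12 N) in A2.
  specialize (Ha t). rewrite (herm_conj (Gam 2%nat t) (Gam 3%nat t)) in E2, Ha.
  assert (herm (Gam 2%nat t) (Gam 3%nat t) = Copp Ci) as E3.
  { revert E2 Ha. generalize (herm (Gam 2%nat t) (Gam 3%nat t)). intros z E2 Ha.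
    apply (f_equal re) in E2. simpl in E2, Ha. Ccomp; lra. }
  rewrite E3 in A2.
  assert (herm (Gam 1%nat t) (Gam 3%nat t) = RtoC (- 2 * c)) as E4.
  { transitivity (Csub (Cadd (RtoC (2 * c)) (herm (Gam 1%nat t) (Gam 3%nat t))) (RtoC (2 * c))).
    - ring.
    - rewrite E1. Ccomp; ring. }
  rewrite E4 in A1.
  assert (X = Copp C1) as EX.
  { pose proof (f_equal re A2); pose proof (f_equal im A2). simpl in *. Ccomp; lra. }
  assert (Y = Cmul Ci (RtoC (- 2 * c))) as EY.
  { rewrite A1. Ccomp; ring. }
  subst X Y.
  apply C3_eq; [apply (f_equal z1) in K | apply (f_equal z2) in K | apply (f_equal z3) in K];
  apply (Cmul_cancel_l Ci); try exact Ci_neq0; simpl in K |- *; rewrite K; ring [Ci_sq].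
Qed.

(** * Solutions of the structure equation and periodicity *)

Definition expi (x : R) : C := mkC (cos x) (sin x).

Lemma expi_add x y : expi (x + y) = Cmul (expi x) (expi y).
Proof. apply C_eq; simpl; [rewrite cos_plus | rewrite sin_plus]; ring. Qed.
Lemma expi_0 : expi 0 = C1.
Proof. apply C_eq; simpl; [apply cos_0 | apply sin_0]. Qed.
Lemma expi_norm2 x : Cnorm2 (expi x) = 1.
Proof. unfold Cnorm2; simpl. pose proof (sin2_cos2 x). unfold Rsqr in H. lra. Qed.
Lemma expi_neq0 x : expi x <> C0.
Proof.
  intros H. pose proof (expi_norm2 x) as N. rewrite H in N. unfold Cnorm2 in N; simpl in N; lra.
Qed.
Lemma expi_conj x : Cconj (expi x) = expi (- x).
Proof. apply C_eq; simpl; [rewrite cos_neg | rewrite sin_neg]; reflexivity. Qed.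
Lemma expi_2PI_Z k : expi (2 * PI * IZR k) = C1.
Proof.
  assert (forall n : nat, expi (2 * PI * INR n) = C1) as P.
  { intros n. apply C_eq; simpl.
    - rewrite <- cos_0, <- (cos_period 0 n). f_equal; ring.
    - rewrite <- sin_0, <- (sin_period 0 n). f_equal; ring. }
  destruct (Z_le_gt_dec 0%Z k).
  - rewrite <- (Z2Nat.id k), <- INR_IZR_INZ by lia. apply P.
  - replace (2 * PI * IZR k) with (- (2 * PI * INR (Z.to_nat (- k)))).
    2:{ rewrite INR_IZR_INZ, Z2Nat.id by lia. rewrite opp_IZR; ring. }
    rewrite <- expi_conj, P. Ccomp; ring.
Qed.
(** The real part suffices: [cos x = 1 - 2 sin^2 (x/2)] equals 1 only where [sin (x/2)] vanishes. *)
Lemma expi_eq1 x : expi x = C1 -> exists k : Z, x = 2 * PI * IZR k.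
Proof.
  intros H. apply (f_equal re) in H. simpl in H.
  replace x with (2 * (x / 2)) in H by field. rewrite cos_2a_sin in H.
  destruct (sin_eq_0_0 (x / 2)) as [k Hk]; [nra|]. exists k.
  replace x with (2 * (x / 2)) by field. rewrite Hk; ring.
Qed.

Lemma C_deriv_expi mu : C_deriv (fun t => expi (mu * t))
  (fun t => Cmul (Cmul Ci (RtoC mu)) (expi (mu * t))).
Proof.
  intros t.
  assert (derivable_pt_lim (fun s => mu * s) t mu) as L.
  { pose proof (derivable_pt_lim_scal id mu t 1 (derivable_pt_lim_id t)) as X.
    rewrite Rmult_1_r in X. exact X. }
  split; simpl.
  - pose proof (derivable_pt_lim_comp _ cos t _ _ L (derivable_pt_lim_cos _)) as X.
    match goal with |- derivable_pt_lim _ _ ?l' =>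
      replace l' with (- sin (mu * t) * mu) by ring end. exact X.
  - pose proof (derivable_pt_lim_comp _ sin t _ _ L (derivable_pt_lim_sin _)) as X.
    match goal with |- derivable_pt_lim _ _ ?l' =>
      replace l' with (cos (mu * t) * mu) by ring end. exact X.
Qed.

(** Integrating factor: [expi (- mu * t)] times [f] has zero derivative. *)
Lemma linear_ode1 (f : R -> C) mu :
  C_deriv f (fun t => Cmul (Cmul Ci (RtoC mu)) (f t)) ->
  forall t, f t = Cmul (expi (mu * t)) (f 0).
Proof.
  intros H t.
  assert (C_deriv (fun s => Cmul (expi (- mu * s)) (f s)) (fun _ => C0)) as D.
  { eapply C_deriv_ext; [reflexivity| |apply (C_deriv_mul _ _ _ _ (C_deriv_expi (- mu)) H)].
    intros s. cbv beta. Ccomp; ring. }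
  pose proof (C_deriv_zero _ D t) as E. cbv beta in E.
  rewrite Rmult_0_r, expi_0 in E.
  transitivity (Cmul (expi (mu * t)) (Cmul (expi (- mu * t)) (f t))).
  - transitivity (Cmul (Cmul (expi (mu * t)) (expi (- mu * t))) (f t)); [|ring].
    rewrite <- expi_add. replace (mu * t + - mu * t) with 0 by ring. rewrite expi_0; ring.
  - rewrite E; ring.
Qed.

Record scalar_sol (c : R) (f0 f1 f2 f3 : R -> C) : Prop := mkscalar_sol {
  ss0 : C_deriv f0 f1; ss1 : C_deriv f1 f2; ss2 : C_deriv f2 f3;
  ss3 : forall t, f3 t = Cadd (Cmul Ci (f0 t)) (Cmul (RtoC (- 2 * c)) (f1 t)) }.

Lemma lift_scalar_sol {Gam c} (N : natural_lift Gam c) :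
  scalar_sol c (fun t => z1 (Gam 0%nat t)) (fun t => z1 (Gam 1%nat t))
               (fun t => z1 (Gam 2%nat t)) (fun t => z1 (Gam 3%nat t)) /\
  scalar_sol c (fun t => z2 (Gam 0%nat t)) (fun t => z2 (Gam 1%nat t))
               (fun t => z2 (Gam 2%nat t)) (fun t => z2 (Gam 3%nat t)) /\
  scalar_sol c (fun t => z3 (Gam 0%nat t)) (fun t => z3 (Gam 1%nat t))
               (fun t => z3 (Gam 2%nat t)) (fun t => z3 (Gam 3%nat t)).
Proof.
  pose proof (nl_smooth _ _ N) as S. pose proof (lift_ode N) as O.
  destruct (S 0%nat) as (a & b & d), (S 1%nat) as (a' & b' & d'), (S 2%nat) as (a'' & b'' & d'').
  split; [|split]; constructor; try assumption; intros t; rewrite O; reflexivity.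
Qed.

(* [i mu] runs over the roots of the characteristic polynomial [l^3 + 2 c l - i]. *)
Definition eigenvec (c mu : R) (g0 g1 g2 : C3) : C3 :=
  C3add g2 (C3add (C3scale (Cmul Ci (RtoC mu)) g1) (C3scale (RtoC (2 * c - mu ^ 2)) g0)).

(** The characteristic polynomial factors as [(l - i mu) (l^2 + i mu l + 2 c - mu^2)]. Applying the
    quadratic factor to a solution leaves the first-order equation [F' = i mu F]. *)
Lemma scalar_eigen c mu f0 f1 f2 f3 : scalar_sol c f0 f1 f2 f3 -> mu ^ 3 - 2 * c * mu + 1 = 0 ->
  forall t, let F t := Cadd (f2 t) (Cadd (Cmul (Cmul Ci (RtoC mu)) (f1 t))
                          (Cmul (RtoC (2 * c - mu ^ 2)) (f0 t))) in
    F t = Cmul (expi (mu * t)) (F 0).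
Proof.
  intros [D0 D1 D2 O] Hm t F. revert t. apply linear_ode1.
  eapply C_deriv_ext; [reflexivity| |].
  2:{ unfold F. apply C_deriv_add; [exact D2|apply C_deriv_add; apply C_deriv_scal; eassumption]. }
  intros t. unfold F. cbv beta. rewrite O.
  set (a := f0 t); set (b := f1 t); set (d := f2 t).
  transitivity (Cadd (Cmul (Cmul Ci (RtoC mu)) (Cadd d (Cadd (Cmul (Cmul Ci (RtoC mu)) b)
     (Cmul (RtoC (2 * c - mu ^ 2)) a)))) (Cmul (Cmul Ci (RtoC (mu ^ 3 - 2 * c * mu + 1))) a)).
  - Ccomp; ring.
  - rewrite Hm. Ccomp; ring.
Qed.

Lemma eigenvec_flow {Gam c} (N : natural_lift Gam c) mu : mu ^ 3 - 2 * c * mu + 1 = 0 ->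
  forall t, eigenvec c mu (Gam 0%nat t) (Gam 1%nat t) (Gam 2%nat t) =
    C3scale (expi (mu * t)) (eigenvec c mu (Gam 0%nat 0) (Gam 1%nat 0) (Gam 2%nat 0)).
Proof.
  intros Hm t. destruct (lift_scalar_sol N) as (A & B & D).
  apply C3_eq; [apply (scalar_eigen _ _ _ _ _ _ A Hm t)
    | apply (scalar_eigen _ _ _ _ _ _ B Hm t) | apply (scalar_eigen _ _ _ _ _ _ D Hm t)].
Qed.

(** Vieta's relations for [x^3 - 2 c x + 1]; as the sum is zero, the sum of squares encodes the
    second symmetric function [- 2 c]. *)
Record roots (c m1 m2 m3 : R) : Prop := mkroots {
  r_sum : m1 + m2 + m3 = 0; r_prod : m1 * m2 * m3 = - 1;
  r_sq : m1 ^ 2 + m2 ^ 2 + m3 ^ 2 = 4 * c;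
  r_12 : m1 <> m2; r_23 : m2 <> m3; r_13 : m1 <> m3 }.

Lemma roots_cubic {c m1 m2 m3} : roots c m1 m2 m3 ->
  m1 ^ 3 - 2 * c * m1 + 1 = 0 /\ m2 ^ 3 - 2 * c * m2 + 1 = 0 /\ m3 ^ 3 - 2 * c * m3 + 1 = 0.
Proof.
  intros [S P Q _ _ _]. assert (m3 = - m1 - m2) by lra. subst m3.
  assert (2 * c = m1 ^ 2 + m1 * m2 + m2 ^ 2) as -> by nra.
  repeat split; ring_simplify; ring_simplify in P; lra.
Qed.

(** Spectral projection of [g0]: [eigenvec] applies the two other linear factors, whose value at the
    root [i m] is [(i m - i m') (i m - i m'') = - (m - m') (m - m'')]. *)
Definition component (c m m' m'' : R) (g0 g1 g2 : C3) : C3 :=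
  C3scale (RtoC (- / ((m - m') * (m - m'')))) (eigenvec c m g0 g1 g2).

(* Lagrange interpolation at the three characteristic roots. *)
Lemma component_sum c m1 m2 m3 g0 g1 g2 : roots c m1 m2 m3 ->
  C3add (component c m1 m2 m3 g0 g1 g2)
    (C3add (component c m2 m1 m3 g0 g1 g2) (component c m3 m1 m2 g0 g1 g2)) = g0.
Proof.
  intros [S P Q n12 n23 n13]. assert (m3 = - m1 - m2) by lra. subst m3.
  assert (2 * c = m1 ^ 2 + m1 * m2 + m2 ^ 2) as Hc by nra.
  unfold component, eigenvec.
  apply C3_eq; simpl; rewrite Hc; Ccomp; field; repeat split; lra.
Qed.

Lemma lift_solution {Gam c} (N : natural_lift Gam c) m1 m2 m3 : roots c m1 m2 m3 ->
  let V m m' m'' := component c m m' m'' (Gam 0%nat 0) (Gam 1%nat 0) (Gam 2%nat 0) in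
  forall t, Gam 0%nat t =
    C3add (C3scale (expi (m1 * t)) (V m1 m2 m3))
      (C3add (C3scale (expi (m2 * t)) (V m2 m1 m3)) (C3scale (expi (m3 * t)) (V m3 m1 m2))).
Proof.
  intros Hr V t. destruct (roots_cubic Hr) as (E1 & E2 & E3).
  rewrite <- (component_sum c m1 m2 m3 (Gam 0%nat t) (Gam 1%nat t) (Gam 2%nat t) Hr) at 1.
  unfold V, component.
  rewrite (eigenvec_flow N m1 E1 t), (eigenvec_flow N m2 E2 t), (eigenvec_flow N m3 E3 t).
  apply C3_eq; simpl; ring.
Qed.

Lemma frame_neq0 {c g0 g1 g2} : frame c g0 g1 g2 -> g0 <> C3zero.
Proof.
  intros F E. pose proof (fdet _ _ _ _ F) as D. rewrite E in D.
  apply (f_equal im) in D. unfold det3 in D; simpl in D. lra.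
Qed.

(** When the three exponentials agree at [T], translation by [T] multiplies [Gamma] by their common
    value, which is invisible in the projective plane. *)
Lemma periodic_of_expi {Gam c} (N : natural_lift Gam c) m1 m2 m3 T : roots c m1 m2 m3 ->
  0 < T -> expi (m1 * T) = expi (m2 * T) -> expi (m2 * T) = expi (m3 * T) ->
  periodic_curve (Gam 0%nat).
Proof.
  intros Hr HT E1 E2. exists T. split; [exact HT|]. intros t.
  split; [exact (frame_neq0 (lift_frame N _))|].
  exists (expi (- (m2 * T))). split; [apply expi_neq0|].
  rewrite (lift_solution N m1 m2 m3 Hr t), (lift_solution N m1 m2 m3 Hr (t + T)).
  rewrite !Rmult_plus_distr_l, !expi_add, <- E2, E1.
  assert (Cmul (expi (- (m2 * T))) (expi (m2 * T)) = C1) as I.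
  { rewrite <- expi_add. replace (- (m2 * T) + m2 * T) with 0 by ring. apply expi_0. }
  apply C3_eq; simpl; ring [I].
Qed.

Lemma C3_deriv_scale l l' F F' : C_deriv l l' -> C3_deriv F F' ->
  C3_deriv (fun t => C3scale (l t) (F t))
    (fun t => C3add (C3scale (l' t) (F t)) (C3scale (l t) (F' t))).
Proof. intros Hl (a & b & d). split; [|split]; apply (C_deriv_mul l l'); assumption. Qed.

Lemma C3_deriv_add F F' G G' : C3_deriv F F' -> C3_deriv G G' ->
  C3_deriv (fun t => C3add (F t) (G t)) (fun t => C3add (F' t) (G' t)).
Proof. intros (a & b & d) (a' & b' & d'). split; [|split].
  - exact (C_deriv_add _ _ _ _ a a').
  - exact (C_deriv_add _ _ _ _ b b').
  - exact (C_deriv_add _ _ _ _ d d').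
Qed.

Lemma C3_deriv_unique F F' G G' : (forall t, F t = G t) ->
  C3_deriv F F' -> C3_deriv G G' -> forall t, F' t = G' t.
Proof.
  intros E (a & b & d) (a' & b' & d') t.
  apply C3_eq; [apply (C_deriv_unique _ _ _ _ (fun t => f_equal z1 (E t)) a a')
    | apply (C_deriv_unique _ _ _ _ (fun t => f_equal z2 (E t)) b b')
    | apply (C_deriv_unique _ _ _ _ (fun t => f_equal z3 (E t)) d d')].
Qed.

(* The multiplier is a cube root of unity because both lifts are normalized, hence constant. *)
Lemma period_multiplier {Gam c} (N : natural_lift Gam c) T :
  (forall t, proj_eq (Gam 0%nat (t + T)) (Gam 0%nat t)) ->
  exists l : R -> C, forall t, Cnorm2 (l t) = 1 /\
    Gam 0%nat t = C3scale (l t) (Gam 0%nat (t + T)) /\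
    Gam 1%nat t = C3scale (l t) (Gam 1%nat (t + T)) /\
    Gam 2%nat t = C3scale (l t) (Gam 2%nat (t + T)).
Proof.
  intros HP. pose proof (nl_smooth _ _ N) as S.
  (* Since [<Gamma'', Gamma> = -1], this pairing recovers the pointwise multiplier by a formula that
     can be differentiated. *)
  set (l := fun t => Copp (herm (Gam 2%nat (t + T)) (Gam 0%nat t))).
  assert (forall t, Gam 0%nat t = C3scale (l t) (Gam 0%nat (t + T))) as E0.
  { intros t. destruct (HP t) as (_ & m & _ & Hm). rewrite Hm at 1. f_equal.
    unfold l. rewrite Hm, herm_scaler, herm_conj, (f02 _ _ _ _ (lift_frame N (t + T))).
    Ccomp; ring. }
  assert (forall j k, exists h', C_deriv (fun t => herm (Gam j (t + T)) (Gam k t)) h' /\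
     forall t, h' t = Cadd (herm (Gam (Datatypes.S j) (t + T)) (Gam k t))
                 (herm (Gam j (t + T)) (Gam (Datatypes.S k) t))) as DH.
  { intros j k. eexists. split; [|reflexivity].
    exact (herm_deriv _ _ _ _ (C3_deriv_shift _ _ T (S j)) (S k)). }
  assert (exists l1 l2, C_deriv l l1 /\ C_deriv l1 l2) as (l1 & l2 & D1 & D2).
  { destruct (DH 2%nat 0%nat) as (h1 & D1 & E1).
    destruct (DH 3%nat 0%nat) as (h2 & D2 & E2).
    destruct (DH 2%nat 1%nat) as (h3 & D3 & E3).
    exists (fun t => Cmul (Copp C1) (h1 t)), (fun t => Cmul (Copp C1) (Cadd (h2 t) (h3 t))). split.
    - eapply C_deriv_ext; [| reflexivity | apply (C_deriv_scal (Copp C1) _ _ D1)].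
      intros t; unfold l; ring.
    - apply C_deriv_scal. eapply C_deriv_ext; [| reflexivity | apply (C_deriv_add _ _ _ _ D2 D3)].
      intros t; rewrite E1; reflexivity. }
  assert (forall k, C3_deriv (fun t => Gam k (t + T)) (fun t => Gam (Datatypes.S k) (t + T))) as ST.
  { intros k. exact (C3_deriv_shift _ _ T (S k)). }
  pose proof (C3_deriv_unique _ _ _ _ E0 (S 0%nat) (C3_deriv_scale _ _ _ _ D1 (ST 0%nat))) as E1.
  cbv beta in E1.
  pose proof (C3_deriv_unique _ _ _ _ E1 (S 1%nat)
    (C3_deriv_add _ _ _ _ (C3_deriv_scale _ _ _ _ D2 (ST 0%nat))
       (C3_deriv_scale _ _ _ _ D1 (ST 1%nat)))) as E2.
  cbv beta in E2.
  assert (forall t, Cmul (l t) (Cmul (l t) (l t)) = C1) as L3.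
  { intros t. apply (Cmul_cancel_l Ci); [exact Ci_neq0|].
    transitivity (det3 (Gam 0%nat t) (Gam 1%nat t) (Gam 2%nat t)).
    (* The terms carrying derivatives of [l] are multiples of earlier columns and drop out of the
       determinant. *)
    - rewrite E0, E1, E2.
      transitivity (Cmul (Cmul (l t) (Cmul (l t) (l t)))
         (det3 (Gam 0%nat (t + T)) (Gam 1%nat (t + T)) (Gam 2%nat (t + T)))).
      + rewrite (nl_det _ _ N); ring.
      + unfold det3; simpl; ring.
    - rewrite (nl_det _ _ N); ring. }
  assert (forall t, l1 t = C0) as L1.
  { intros t.
    pose proof (C_deriv_of_const _ _ _ L3
      (C_deriv_mul _ _ _ _ D1 (C_deriv_mul _ _ _ _ D1 D1)) t) as X. cbv beta in X.
    assert (RtoC 3 = Cadd C1 (Cadd C1 C1)) as T3 by (Ccomp; ring).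
    apply (Cmul_cancel_l (RtoC 3)); [apply RtoC_neq0; lra|].
    transitivity (Cmul (l t) (Cadd (Cmul (l1 t) (Cmul (l t) (l t)))
      (Cmul (l t) (Cadd (Cmul (l1 t) (l t)) (Cmul (l t) (l1 t)))))).
    - rewrite T3. ring [(L3 t)].
    - rewrite X; ring. }
  assert (forall t, l2 t = C0) as L2.
  { intros t. exact (C_deriv_of_const _ _ _ L1 D2 t). }
  assert (forall t, Gam 1%nat t = C3scale (l t) (Gam 1%nat (t + T))) as F1.
  { intros t. rewrite E1, L1. apply C3_eq; simpl; ring. }
  clearbody l. exists l. intros t. repeat split; auto.
  - pose proof (f11 _ _ _ _ (lift_frame N t)) as A.
    rewrite F1, herm_scaler, herm_scalel, (f11 _ _ _ _ (lift_frame N (t + T))) in A.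
    apply (f_equal re) in A. simpl in A. unfold Cnorm2. lra.
  - rewrite E2, L1, L2. apply C3_eq; simpl; ring.
Qed.

(** [P] is nondecreasing and takes the same value at both ends of each period, so it is constant. *)
Lemma periodic_monotone_derivative (P P' : R -> R) T : 0 < T ->
  (forall t, derivable_pt_lim P t (P' t)) -> (forall t, 0 <= P' t) ->
  (forall t, P (t + T) = P t) -> forall t, P' t = 0.
Proof.
  intros HT HD Hp HT' t.
  set (pr := fun s => exist _ (P' s) (HD s) : derivable_pt P s).
  assert (increasing P) as Hi by (apply (nonneg_derivative_1 P pr); exact Hp).
  assert (forall s, t <= s <= t + T -> P s = P t) as K.
  { intros s [a b]. apply Rle_antisym; [rewrite <- (HT' t)|]; apply Hi; assumption. }
  assert (forall s, t - T <= s <= t -> P s = P t) as K'.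
  { intros s [a b]. apply Rle_antisym; [apply Hi; assumption|].
    rewrite <- (HT' s). apply Hi; lra. }
  apply (uniqueness_limite P t); [apply HD|].
  intros eps He. exists (mkposreal T HT). intros h Hh Hh'. simpl in Hh'.
  apply Rabs_def2 in Hh' as [a b].
  replace (P (t + h)) with (P t).
  - unfold Rdiv; rewrite Rminus_diag, Rmult_0_l, Rminus_diag, Rabs_R0; exact He.
  - symmetry. destruct (Rle_dec 0 h); [apply K | apply K']; lra.
Qed.

(* With [k = f' + i w f], the other two roots give [k'' = i w k' + k / w], so
   [(|k|^2)'' = 2 |k' - i (w/2) k|^2 + 2 (1/w - w^2/4) |k|^2 >= 0]. *)
Lemma scalar_no_period c w f0 f1 f2 f3 T l : scalar_sol c f0 f1 f2 f3 ->
  0 < w -> w ^ 3 - 2 * c * w - 1 = 0 -> w ^ 3 <= 4 -> 0 < T ->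
  (forall t, Cnorm2 (l t) = 1 /\ f0 t = Cmul (l t) (f0 (t + T)) /\
     f1 t = Cmul (l t) (f1 (t + T)) /\ f2 t = Cmul (l t) (f2 (t + T))) ->
  forall t, Cadd (f2 t) (Cmul (Cmul Ci (RtoC w)) (f1 t)) =
    Cmul (Cmul Ci (RtoC (w / 2))) (Cadd (f1 t) (Cmul (Cmul Ci (RtoC w)) (f0 t))).
Proof.
  intros [D0 D1 D2 O] Hw Hc Hw4 HT Hl.
  set (k := fun t => Cadd (f1 t) (Cmul (Cmul Ci (RtoC w)) (f0 t))).
  set (k1 := fun t => Cadd (f2 t) (Cmul (Cmul Ci (RtoC w)) (f1 t))).
  set (k2 := fun t => Cadd (Cmul (Cmul Ci (RtoC w)) (k1 t)) (Cmul (RtoC (/ w)) (k t))).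
  assert (C_deriv k k1) as Dk by (apply C_deriv_add; [|apply C_deriv_scal]; assumption).
  assert (C_deriv k1 k2) as Dk1.
  { eapply C_deriv_ext; [reflexivity| |].
    2:{ unfold k1. apply C_deriv_add; [|apply C_deriv_scal]; eassumption. }
    intros t. cbv beta. rewrite O. unfold k2, k1, k.
    assert (2 * c = w ^ 2 - / w) as C2.
    { replace (2 * c) with ((2 * c * w) / w) by (field; lra).
      replace (2 * c * w) with (w ^ 3 - 1) by lra. field; lra. }
    replace (- 2 * c) with (- (w ^ 2 - / w)) by lra.
    Ccomp; field; lra. }
  (* The function differentiated here is half the derivative of [|k|^2]; it is [T]-periodic because
     the multiplier has modulus 1. *)
  assert (forall t, derivable_pt_lim (fun s => re (Cmul (Cconj (k s)) (k1 s))) t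
    (Cnorm2 (Csub (k1 t) (Cmul (Cmul Ci (RtoC (w / 2))) (k t))) + (/ w - w ^ 2 / 4) * Cnorm2 (k t))) as DP.
  { intros t. destruct (C_deriv_mul _ _ _ _ (C_deriv_conj _ _ Dk) Dk1 t) as [X _].
    match goal with |- derivable_pt_lim _ _ ?l' =>
      match type of X with derivable_pt_lim _ _ ?l => replace l' with l end end; [exact X|].
    unfold k2, Cnorm2. generalize (k t) (k1 t). intros u v. simpl. field; lra. }
  (* The frequencies other than [- w] solve [x^2 - w x + 1/w = 0], whose discriminant is [-4] times
     this quantity. *)
  assert (0 <= / w - w ^ 2 / 4) as Hpos.
  { replace (/ w - w ^ 2 / 4) with ((4 - w ^ 3) * / (4 * w)) by (field; lra).
    apply Rmult_le_pos; [lra|]. apply Rlt_le, Rinv_0_lt_compat; lra. }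
  intros t.
  assert (Cnorm2 (Csub (k1 t) (Cmul (Cmul Ci (RtoC (w / 2))) (k t)))
     + (/ w - w ^ 2 / 4) * Cnorm2 (k t) = 0) as Z.
  { revert t. apply (periodic_monotone_derivative _ _ T HT DP).
    - intros t. apply Rplus_le_le_0_compat; [|apply Rmult_le_pos; [exact Hpos|]];
      unfold Cnorm2; nra.
    - intros t. destruct (Hl t) as (n & e0 & e1 & e2).
      assert (k t = Cmul (l t) (k (t + T))) as -> by (unfold k; rewrite e0, e1; ring).
      assert (k1 t = Cmul (l t) (k1 (t + T))) as -> by (unfold k1; rewrite e2, e1; ring).
      rewrite conj_mul.
      transitivity (re (Cmul (Cmul (Cconj (l t)) (l t)) (Cmul (Cconj (k (t + T))) (k1 (t + T))))).
      + rewrite conj_mul_self, n. simpl; ring.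
      + f_equal; ring. }
  assert (0 <= (/ w - w ^ 2 / 4) * Cnorm2 (k t)) as Y
    by (apply Rmult_le_pos; [exact Hpos|]; unfold Cnorm2; nra).
  set (d := Csub (k1 t) (Cmul (Cmul Ci (RtoC (w / 2))) (k t))) in *.
  assert (Cnorm2 d = 0) as Nd.
  { assert (0 <= Cnorm2 d) by (unfold Cnorm2; nra). lra. }
  assert (d = C0) as Ed by (apply Cnorm2_eq0; exact Nd).
  fold (k1 t) (k t).
  transitivity (Cadd d (Cmul (Cmul Ci (RtoC (w / 2))) (k t))).
  - unfold d; ring.
  - rewrite Ed; ring.
Qed.

(** Periodicity would force [k' = i (w/2) k] in all three coordinates, making [Gamma''] a
    combination of [Gamma] and [Gamma'] against [det = i]. *)
Lemma no_period {Gam c} (N : natural_lift Gam c) w :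
  0 < w -> w ^ 3 - 2 * c * w - 1 = 0 -> w ^ 3 <= 4 -> ~ periodic_curve (Gam 0%nat).
Proof.
  intros Hw Hc H4 (T & HT & HP). destruct (period_multiplier N T HP) as [l Hl].
  destruct (lift_scalar_sol N) as (A & B & D).
  assert (forall pr : C3 -> C, (forall a v, pr (C3scale a v) = Cmul a (pr v)) ->
     forall t, Cnorm2 (l t) = 1 /\ pr (Gam 0%nat t) = Cmul (l t) (pr (Gam 0%nat (t + T))) /\
     pr (Gam 1%nat t) = Cmul (l t) (pr (Gam 1%nat (t + T))) /\
     pr (Gam 2%nat t) = Cmul (l t) (pr (Gam 2%nat (t + T)))) as K.
  { intros pr Hpr t. destruct (Hl t) as (n & e0 & e1 & e2).
    split; [exact n|]. rewrite <- !Hpr, <- e0, <- e1, <- e2. auto. }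
  pose proof (scalar_no_period _ _ _ _ _ _ T l A Hw Hc H4 HT (K z1 (fun _ _ => eq_refl)) 0) as X1.
  pose proof (scalar_no_period _ _ _ _ _ _ T l B Hw Hc H4 HT (K z2 (fun _ _ => eq_refl)) 0) as X2.
  pose proof (scalar_no_period _ _ _ _ _ _ T l D Hw Hc H4 HT (K z3 (fun _ _ => eq_refl)) 0) as X3.
  cbv beta in X1, X2, X3.
  pose proof (nl_det _ _ N 0) as E.
  set (g0 := Gam 0%nat 0) in *. set (g1 := Gam 1%nat 0) in *. set (g2 := Gam 2%nat 0) in *.
  assert (g2 = C3add (C3scale (Cmul Ci (RtoC (- w / 2))) g1) (C3scale (RtoC (- w ^ 2 / 2)) g0)) as E2.
  { assert (forall u v x : C, Cadd u (Cmul (Cmul Ci (RtoC w)) v) =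
      Cmul (Cmul Ci (RtoC (w / 2))) (Cadd v (Cmul (Cmul Ci (RtoC w)) x)) ->
      u = Cadd (Cmul (Cmul Ci (RtoC (- w / 2))) v) (Cmul (RtoC (- w ^ 2 / 2)) x)) as G.
    { intros u v x H.
      transitivity (Csub (Cadd u (Cmul (Cmul Ci (RtoC w)) v)) (Cmul (Cmul Ci (RtoC w)) v)); [ring|].
      rewrite H. Ccomp; field. }
    apply C3_eq; simpl; apply G; assumption. }
  assert (det3 g0 g1 g2 = C0) as Z by (rewrite E2; unfold det3; simpl; ring).
  rewrite Z in E. exact (Ci_neq0 (eq_sym E)).
Qed.

(** Over one period the eigenvector is multiplied by [expi (mu * T)] and also by the inverse of [l].
    It is nonzero because replacing [Gamma''] by it keeps the determinant equal to [i]. *)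
Lemma expi_of_periodic {Gam c} (N : natural_lift Gam c) T mu :
  mu ^ 3 - 2 * c * mu + 1 = 0 ->
  forall l, Gam 0%nat 0 = C3scale l (Gam 0%nat (0 + T)) ->
    Gam 1%nat 0 = C3scale l (Gam 1%nat (0 + T)) -> Gam 2%nat 0 = C3scale l (Gam 2%nat (0 + T)) ->
  Cmul l (expi (mu * T)) = C1.
Proof.
  intros Hm l e0 e1 e2.
  pose proof (eigenvec_flow N mu Hm (0 + T)) as F.
  set (v := eigenvec c mu (Gam 0%nat 0) (Gam 1%nat 0) (Gam 2%nat 0)) in *.
  assert (v = C3scale (Cmul l (expi (mu * T))) v) as E.
  { rewrite Rplus_0_l in F, e0, e1, e2.
    transitivity (C3scale l (eigenvec c mu (Gam 0%nat T) (Gam 1%nat T) (Gam 2%nat T))).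
    - unfold v. rewrite e0, e1, e2. apply C3_eq; simpl; ring.
    - rewrite F. apply C3_eq; simpl; ring. }
  assert (v <> C3zero) as Hv.
  { intros Z. pose proof (nl_det _ _ N 0) as D.
    assert (det3 (Gam 0%nat 0) (Gam 1%nat 0) v = Ci) as D'.
    { rewrite <- D. unfold v, eigenvec, det3; simpl; ring. }
    rewrite Z in D'. apply (f_equal im) in D'. unfold det3 in D'; simpl in D'. lra. }
  set (a := Cmul l (expi (mu * T))) in *.
  assert (forall x, x = Cmul a x -> x = C0 \/ a = C1) as G.
  { intros x Hx. destruct (Cmul_integral (Csub a C1) x) as [H|H]; [| |left; exact H].
    - transitivity (Csub (Cmul a x) x); [ring|]. rewrite <- Hx; ring.
    - right. replace a with (Cadd (Csub a C1) C1) by ring. rewrite H; ring. }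
  destruct (G (z1 v) (f_equal z1 E)) as [v1|]; [|assumption].
  destruct (G (z2 v) (f_equal z2 E)) as [v2|]; [|assumption].
  destruct (G (z3 v) (f_equal z3 E)) as [v3|]; [|assumption].
  exfalso. apply Hv. apply C3_eq; assumption.
Qed.

(** The exponentials at [T] all equal the inverse multiplier, so the ratio of any two of them is
    1. *)
Lemma periodic_commensurable {Gam c} (N : natural_lift Gam c) m1 m2 m3 : roots c m1 m2 m3 ->
  periodic_curve (Gam 0%nat) -> exists T (k1 k2 : Z), 0 < T /\
    (m2 - m1) * T = 2 * PI * IZR k1 /\ (m3 - m2) * T = 2 * PI * IZR k2.
Proof.
  intros Hr (T & HT & HP). destruct (period_multiplier N T HP) as [l Hl].
  destruct (Hl 0) as (_ & e0 & e1 & e2). destruct (roots_cubic Hr) as (E1 & E2 & E3).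
  pose proof (expi_of_periodic N T m1 E1 _ e0 e1 e2) as A1.
  pose proof (expi_of_periodic N T m2 E2 _ e0 e1 e2) as A2.
  pose proof (expi_of_periodic N T m3 E3 _ e0 e1 e2) as A3.
  assert (l 0 <> C0) as L0.
  { intros Z. rewrite Z in A1. apply (f_equal re) in A1. simpl in A1. lra. }
  assert (forall a b, Cmul (l 0) (expi (a * T)) = C1 -> Cmul (l 0) (expi (b * T)) = C1 ->
     exists k : Z, (b - a) * T = 2 * PI * IZR k) as G.
  { intros a b Ha Hb. apply expi_eq1. apply (Cmul_cancel_l _ _ _ L0).
    rewrite <- Ha in Hb. apply (Cmul_cancel_l _ _ _ L0) in Hb.
    replace ((b - a) * T) with (b * T + - (a * T)) by ring.
    rewrite expi_add, Hb, <- expi_add.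
    replace (a * T + - (a * T)) with 0 by ring. rewrite expi_0. ring. }
  destruct (G _ _ A1 A2) as [k1 H1]. destruct (G _ _ A2 A3) as [k2 H2].
  exists T, k1, k2. auto.
Qed.

(** * The parameters r(q) and c(q) *)

Lemma exists_neg_cubic_root c : exists w, 0 < w /\ w ^ 3 - 2 * c * w - 1 = 0.
Proof.
  set (f := fun w => w ^ 3 - 2 * c * w - 1).
  assert (continuity f) as Hf by (unfold f; apply derivable_continuous; reg).
  (* [f 0 = -1], while [W] is large enough that [W (W^2 - 2 c)] exceeds 1. *)
  set (W := 2 * Rabs c + 2).
  pose proof (Rabs_pos c) as P. pose proof (Rle_abs c) as L.
  destruct (IVT f 0 W Hf) as (w & Hw & Ew).
  - unfold W; lra.
  - unfold f; lra.
  - unfold f, W.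
    assert (0 <= (2 * Rabs c + 2) * (2 * Rabs c - 2 * c)) by (apply Rmult_le_pos; lra).
    assert (0 <= Rabs c ^ 2) by nra. assert (0 <= Rabs c ^ 3) by (apply pow_le; lra).
    nra.
  - exists w. split; [|exact Ew]. destruct (Req_dec w 0) as [->|]; [|lra].
    unfold f in Ew; lra.
Qed.

(** Dividing the cubic by [x + w] leaves [x^2 - w x + 1/w], with discriminant [w^2 - 4/w > 0]; both
    its roots are positive, having positive sum and product. *)
Lemma roots_of_large_w c w : 0 < w -> w ^ 3 - 2 * c * w - 1 = 0 -> 4 < w ^ 3 ->
  exists m2 m3, 0 < m2 /\ m2 < m3 /\ roots c (- w) m2 m3.
Proof.
  intros Hw E H4.
  assert (0 < w ^ 2 - 4 / w) as Hd.
  { replace (w ^ 2 - 4 / w) with ((w ^ 3 - 4) * / w) by (field; lra).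
    apply Rmult_lt_0_compat; [lra|apply Rinv_0_lt_compat; lra]. }
  set (s := sqrt (w ^ 2 - 4 / w)).
  assert (0 < s) as Hs by (apply sqrt_lt_R0; exact Hd).
  assert (s * s = w ^ 2 - 4 / w) as Es by (apply sqrt_sqrt; lra).
  assert (0 < 4 / w) by (apply Rdiv_lt_0_compat; lra).
  assert (s < w) as Hsw by nra.
  assert (w * (s * s) = w ^ 3 - 4) as Ews by (rewrite Es; field; lra).
  exists ((w - s) / 2), ((w + s) / 2).
  split; [lra|]. split; [lra|]. constructor; try lra; nra.
Qed.

(** [r^2] is the smaller root of [x^2 - (4 + 8 q) x + 4]; the roots have product 4, so it lies below
    2. *)
Lemma rfun_spec q : 1 < q ->
  let r := rfun q in 0 < r /\ r ^ 2 < 2 /\ (2 - r ^ 2) ^ 2 = 8 * q * r ^ 2.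
Proof.
  intros Hq r.
  set (s := sqrt (q * (1 + q))).
  assert (0 < s) as Hs by (apply sqrt_lt_R0; nra).
  assert (s * s = q * (1 + q)) as Es by (apply sqrt_sqrt; nra).
  assert (q < s) as H1 by nra. assert (2 * s < 1 + 2 * q) as H2 by nra.
  assert (0 < 2 + 4 * q - 4 * s) as Hp by lra.
  assert (r ^ 2 = 2 + 4 * q - 4 * s) as Er.
  { unfold r, rfun. fold s. simpl. rewrite Rmult_1_r. apply sqrt_sqrt; lra. }
  split; [apply sqrt_lt_R0; exact Hp|]. rewrite Er. split; nra.
Qed.

Lemma pow23_cube x : 0 < x -> pow23 (- x ^ 3) = x ^ 2.
Proof.
  intros Hx. unfold pow23. rewrite Rabs_Ropp, Rabs_pos_eq by (apply pow_le; lra).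
  rewrite <- (Rpower_pow 3 x Hx), Rpower_mult, <- (Rpower_pow 2 x Hx). f_equal.
  simpl; field.
Qed.

(** Substituting [q = (2 - r^2)^2 / (8 r^2)] turns the base of the power 2/3 into minus the cube of
    [8 r^2 g], and [r] then cancels. *)
Lemma cfun_eq q g : 1 < q -> 0 < g -> g ^ 3 = (q + 2) * (q - 1) * (2 * q + 1) ->
  cfun q = 3 * (q ^ 2 + q + 1) / (2 * g ^ 2).
Proof.
  intros Hq Hg Eg. destruct (rfun_spec q Hq) as (Hr & _ & Er).
  unfold cfun. set (r := rfun q) in *. clearbody r. cbv zeta.
  assert (q = (2 - r ^ 2) ^ 2 / (8 * r ^ 2)) as Eq.
  { rewrite Er. field. lra. }
  assert (2 * (-64 + 528 * r ^ 4 + 132 * r ^ 8 - r ^ 12) = - (8 * r ^ 2 * g) ^ 3) as ->.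
  { replace ((8 * r ^ 2 * g) ^ 3) with ((8 * r ^ 2) ^ 3 * g ^ 3) by ring.
    rewrite Eg, Eq. field. lra. }
  assert (0 < r ^ 2) by (apply pow_lt; exact Hr).
  rewrite pow23_cube by nra. rewrite Eq. field. lra.
Qed.

Lemma exists_cube_root x : 0 < x -> exists g, 0 < g /\ g ^ 3 = x.
Proof.
  intros Hx. exists (Rpower x (1 / 3)). split; [apply exp_pos|].
  rewrite <- Rpower_pow by apply exp_pos. rewrite Rpower_mult.
  replace (1 / 3 * INR 3) with 1 by (simpl; field). apply Rpower_1; exact Hx.
Qed.

(* The frequencies of the model curve are [-d * (nu - (q - 1) / 3)] for [nu = q, 0, -1]. *)
Lemma roots_of_cfun q : 1 < q -> exists d, 0 < d /\
  roots (cfun q) (- (d * (2 * q + 1) / 3)) (d * (q - 1) / 3) (d * (q + 2) / 3).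
Proof.
  intros Hq. destruct (exists_cube_root ((q + 2) * (q - 1) * (2 * q + 1))) as (g & Hg & Eg).
  { repeat apply Rmult_lt_0_compat; lra. }
  assert (0 < 3 / g) as Hd by (apply Rdiv_lt_0_compat; lra).
  (* This scale makes the product of the three frequencies, [- d^3 g^3 / 27], equal to [-1]. *)
  exists (3 / g). split; [exact Hd|].
  rewrite (cfun_eq q g Hq Hg Eg).
  constructor; [field; lra | | field; lra | nra | nra | nra].
  transitivity (- ((q + 2) * (q - 1) * (2 * q + 1)) / g ^ 3); [field; lra|].
  rewrite <- Eg. field. lra.
Qed.

Lemma cfun_of_roots c m1 m2 m3 : 0 < m2 -> m2 < m3 -> roots c m1 m2 m3 ->
  1 < (m2 - m1) / (m3 - m2) /\ c = cfun ((m2 - m1) / (m3 - m2)).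
Proof.
  intros H2 H3 [S P Q _ _ _].
  assert (1 < (m2 - m1) / (m3 - m2)) as Hq.
  { apply Rmult_lt_reg_r with (m3 - m2); [lra|]. unfold Rdiv.
    rewrite Rmult_assoc, Rinv_l by lra. lra. }
  split; [exact Hq|].
  (* As the roots sum to zero, [q + 2], [q - 1] and [2 q + 1] are [3 m3], [3 m2] and [- 3 m1] over
     [m3 - m2]; hence this value of [g]. *)
  assert (0 < 3 / (m3 - m2)) as Hg by (apply Rdiv_lt_0_compat; lra).
  assert (m1 = - m2 - m3) by lra. subst m1.
  rewrite (cfun_eq _ (3 / (m3 - m2)) Hq Hg).
  - replace c with (((- m2 - m3) ^ 2 + m2 ^ 2 + m3 ^ 2) / 4) by lra. field. lra.
  - transitivity (27 * (- ((- m2 - m3) * m2 * m3)) / (m3 - m2) ^ 3).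
    + rewrite P. field. lra.
    + field. lra.
Qed.

(** * The model curve *)

(** Cramer's rule provides coordinates, and inverting the Gram matrix identifies them as Hermitian
    products. *)
Lemma frame_coordinates {c g0 g1 g2} (F : frame c g0 g1 g2) z :
  z = C3add (C3scale (Copp (Cadd (herm g2 z) (Cmul (RtoC (2 * c)) (herm g0 z)))) g0)
        (C3add (C3scale (herm g1 z) g1) (C3scale (Copp (herm g0 z)) g2)).
Proof.
  destruct F as [h00 h01 h02 h11 h12 h22 D].
  pose proof (cramer g0 g1 g2 z) as K. rewrite D in K.
  set (X := det3 z g1 g2) in K. set (Y := det3 g0 z g2) in K. set (Z := det3 g0 g1 z) in K.
  pose proof (f_equal (herm g0) K) as K0. pose proof (f_equal (herm g1) K) as K1.
  pose proof (f_equal (herm g2) K) as K2.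
  rewrite !herm_addr, !herm_scaler in K0, K1, K2.
  rewrite (herm_conj g0 g1) in K1. rewrite (herm_conj g0 g2), (herm_conj g1 g2) in K2.
  rewrite h00, h01, h02 in K0. rewrite h01, h11, h12 in K1. rewrite h02, h12, h22 in K2.
  assert (Cconj C0 = C0) as c0 by (Ccomp; ring).
  assert (Cconj (Copp C1) = Copp C1) as c1 by (Ccomp; ring).
  rewrite c0 in K1. rewrite c0, c1 in K2.
  assert (Z = Copp (Cmul Ci (herm g0 z))) as EZ by (rewrite K0; ring).
  assert (Y = Cmul Ci (herm g1 z)) as EY by (rewrite K1; ring).
  assert (X = Copp (Cadd (Cmul Ci (herm g2 z)) (Cmul (RtoC (2 * c)) (Cmul Ci (herm g0 z))))) as EX.
  { rewrite K2, EZ. ring. }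
  rewrite EX, EY, EZ in K.
  apply C3_eq; [apply (f_equal z1) in K | apply (f_equal z2) in K | apply (f_equal z3) in K];
  apply (Cmul_cancel_l Ci _ _ Ci_neq0); etransitivity; try exact K; simpl; ring.
Qed.

Definition frame_image (c : R) (g0 g1 g2 l0 l1 l2 z : C3) : C3 :=
  C3add (C3scale (Copp (Cadd (herm g2 z) (Cmul (RtoC (2 * c)) (herm g0 z)))) l0)
    (C3add (C3scale (herm g1 z) l1) (C3scale (Copp (herm g0 z)) l2)).

Definition basis (j : nat) : C3 :=
  match j with
  | 0%nat => mkC3 C1 C0 C0 | 1%nat => mkC3 C0 C1 C0 | _ => mkC3 C0 C0 C1
  end.
Definition coord (i : nat) (z : C3) : C :=
  match i with 0%nat => z1 z | 1%nat => z2 z | _ => z3 z end.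
Definition frame_mat (c : R) (g0 g1 g2 l0 l1 l2 : C3) : Mat :=
  fun i j => coord i (frame_image c g0 g1 g2 l0 l1 l2 (basis j)).

Lemma matvec_frame_mat c g0 g1 g2 l0 l1 l2 z :
  matvec (frame_mat c g0 g1 g2 l0 l1 l2) z = frame_image c g0 g1 g2 l0 l1 l2 z.
Proof. apply C3_eq; unfold frame_mat, frame_image, herm; simpl; ring. Qed.

(** In frame coordinates the form depends on [c] alone, so carrying coordinates from one frame to
    another is an isometry. *)
Lemma frame_image_herm {c g0 g1 g2 l0 l1 l2} :
  frame c g0 g1 g2 -> frame c l0 l1 l2 -> forall z w,
  herm (frame_image c g0 g1 g2 l0 l1 l2 z) (frame_image c g0 g1 g2 l0 l1 l2 w) = herm z w.
Proof.
  intros F G z w.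
  assert (forall k0 k1 k2, frame c k0 k1 k2 -> forall a b d a' b' d',
    herm (C3add (C3scale a k0) (C3add (C3scale b k1) (C3scale d k2)))
         (C3add (C3scale a' k0) (C3add (C3scale b' k1) (C3scale d' k2))) =
    Cadd (Cadd (Cmul (Cconj b) b') (Cmul (RtoC (2 * c)) (Cmul (Cconj d) d')))
      (Copp (Cadd (Cmul (Cconj a) d') (Cmul (Cconj d) a')))) as K.
  { intros k0 k1 k2 [h00 h01 h02 h11 h12 h22 _] a b d a' b' d'.
    rewrite !herm_addl, !herm_addr, !herm_scalel, !herm_scaler.
    rewrite (herm_conj k0 k1), (herm_conj k0 k2), (herm_conj k1 k2), h00, h01, h02, h11, h12, h22.
    assert (Cconj C0 = C0) as c0 by (Ccomp; ring).
    assert (Cconj (Copp C1) = Copp C1) as c1 by (Ccomp; ring).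
    rewrite c0, c1. ring. }
  unfold frame_image. rewrite (K _ _ _ G), <- (K _ _ _ F), <- !(frame_coordinates F). reflexivity.
Qed.

Lemma det3_matvec A u v w :
  det3 (matvec A u) (matvec A v) (matvec A w) = Cmul (matdet A) (det3 u v w).
Proof. unfold det3, matdet, det3, matvec, col; simpl; ring. Qed.

(** Unimodularity comes from the determinant [i] shared by the two frames. *)
Lemma frame_mat_spec {c g0 g1 g2 l0 l1 l2} : frame c g0 g1 g2 -> frame c l0 l1 l2 ->
  let A := frame_mat c g0 g1 g2 l0 l1 l2 in
  inG A /\ matvec A g0 = l0 /\ matvec A g1 = l1 /\ matvec A g2 = l2.
Proof.
  intros F G A.
  assert (matvec A g0 = l0 /\ matvec A g1 = l1 /\ matvec A g2 = l2) as (E0 & E1 & E2).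
  { unfold A. rewrite !matvec_frame_mat. destruct F as [h00 h01 h02 h11 h12 h22 _].
    unfold frame_image.
    rewrite (herm_conj g0 g1), (herm_conj g0 g2), (herm_conj g1 g2), h00, h01, h02, h11, h12, h22.
    assert (Cconj C0 = C0) as c0 by (Ccomp; ring).
    assert (Cconj (Copp C1) = Copp C1) as c1 by (Ccomp; ring).
    rewrite c0, c1. repeat split; apply C3_eq; simpl; ring. }
  split; [split|auto].
  - pose proof (det3_matvec A g0 g1 g2) as D.
    rewrite E0, E1, E2, (fdet _ _ _ _ F), (fdet _ _ _ _ G) in D.
    apply (Cmul_cancel_l Ci _ _ Ci_neq0).
    transitivity (Cmul (matdet A) Ci); [ring|]. rewrite <- D; ring.
  - intros z w. unfold A. rewrite !matvec_frame_mat. apply frame_image_herm; assumption.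
Qed.

(* Eigenvectors of the one-parameter group generating the model curve, with Hermitian norms
   [1 / (d^2 q (q + 1))], [- 1 / (d^2 q)] and [1 / (d^2 (q + 1))]. *)
Definition model_v1 (k r : R) : C3 := mkC3 C0 (Cmul (RtoC (4 * r * k)) (Copp Ci)) C0.
Definition model_v2 (k r : R) : C3 :=
  C3scale (RtoC (k * (2 + r ^ 2))) (mkC3 (Copp Ci) C0 C1).
Definition model_v3 (k r : R) : C3 :=
  C3scale (RtoC (k * (2 - r ^ 2))) (mkC3 (Copp Ci) C0 (Copp C1)).

(** The derivative of order [j] at 0 of the model sum of exponentials, for [j] at most 2; [p m] is
    [(i m)^j], and larger indices repeat [j = 2]. *)
Definition model_jet (k r m1 m2 m3 : R) (j : nat) : C3 :=
  let p m := match j with 0%nat => C1 | 1%nat => Cmul Ci (RtoC m) | _ => RtoC (- m ^ 2) end in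
  C3add (C3scale (p m1) (model_v1 k r))
    (C3add (C3scale (p m2) (model_v2 k r)) (C3scale (p m3) (model_v3 k r))).

(** The eigenvectors are mutually orthogonal, so each Gram entry is a sum of three terms weighted by
    their norms. The factor [/ (4 * d * r * s)] normalizes the determinant to [i]. *)
Lemma model_frame q d r s (c := (d ^ 2 * (q ^ 2 + q + 1)) / 6) :
  0 < d -> 0 < q -> 0 < r -> r ^ 2 < 2 -> 0 < s -> s ^ 2 = q * (q + 1) ->
  (2 - r ^ 2) ^ 2 = 8 * q * r ^ 2 ->
  let j := model_jet (/ (4 * d * r * s)) r (- (d * (2 * q + 1) / 3)) (d * (q - 1) / 3)
    (d * (q + 2) / 3) in
  frame c (j 0%nat) (j 1%nat) (j 2%nat).
Proof.
  intros Hd Hq Hr Hr2 Hs Es Er j.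
  assert ((2 + r ^ 2) ^ 2 = 8 * (q + 1) * r ^ 2) as Er' by nra.
  (* Both sides have the same square, and both are positive. *)
  assert ((2 + r ^ 2) * (2 - r ^ 2) = 8 * s * r ^ 2) as Ers.
  { assert (0 < r ^ 2) by (apply pow_lt; exact Hr).
    assert (((2 + r ^ 2) * (2 - r ^ 2) - 8 * s * r ^ 2) * ((2 + r ^ 2) * (2 - r ^ 2) + 8 * s * r ^ 2) = 0) as X.
    { transitivity ((2 + r ^ 2) ^ 2 * (2 - r ^ 2) ^ 2 - 64 * s ^ 2 * r ^ 4); [ring|].
      rewrite Er, Er', Es. ring. }
    apply Rmult_integral in X as [X|X]; [lra|].
    assert (0 < (2 + r ^ 2) * (2 - r ^ 2)) by (apply Rmult_lt_0_compat; lra). nra. }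
  set (k := / (4 * d * r * s)) in *.
  set (a := 2 + r ^ 2) in *. set (b := 2 - r ^ 2) in *.
  assert (k ^ 2 * a ^ 2 = / (2 * d ^ 2 * q)) as N2.
  { rewrite Er'. unfold k. replace ((/ (4 * d * r * s)) ^ 2) with (/ (16 * d ^ 2 * r ^ 2 * s ^ 2))
      by (field; lra). rewrite Es. field. lra. }
  assert (k ^ 2 * b ^ 2 = / (2 * d ^ 2 * (q + 1))) as N3.
  { rewrite Er. unfold k. replace ((/ (4 * d * r * s)) ^ 2) with (/ (16 * d ^ 2 * r ^ 2 * s ^ 2))
      by (field; lra). rewrite Es. field. lra. }
  assert (k ^ 2 * r ^ 2 = / (16 * d ^ 2 * q * (q + 1))) as N1.
  { unfold k. replace ((/ (4 * d * r * s)) ^ 2) with (/ (16 * d ^ 2 * r ^ 2 * s ^ 2))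
      by (field; lra). rewrite Es. field. lra. }
  assert (8 * k ^ 3 * (a * b) * r * (d ^ 3 * s ^ 2) = 1) as ND.
  { rewrite Ers. unfold k. field. lra. }
  set (m1 := - (d * (2 * q + 1) / 3)) in *. set (m2 := d * (q - 1) / 3) in *.
  set (m3 := d * (q + 2) / 3) in *.
  assert (forall u1 u2 u3 w1 w2 w3,
    herm (C3add (C3scale u1 (model_v1 k r)) (C3add (C3scale u2 (model_v2 k r)) (C3scale u3 (model_v3 k r))))
         (C3add (C3scale w1 (model_v1 k r)) (C3add (C3scale w2 (model_v2 k r)) (C3scale w3 (model_v3 k r)))) =
    Cadd (Cmul (RtoC (16 * (k ^ 2 * r ^ 2))) (Cmul (Cconj u1) w1))
      (Cadd (Cmul (RtoC (- 2 * (k ^ 2 * a ^ 2))) (Cmul (Cconj u2) w2))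
        (Cmul (RtoC (2 * (k ^ 2 * b ^ 2))) (Cmul (Cconj u3) w3)))) as HH.
  { intros. unfold herm, model_v1, model_v2, model_v3. fold a b. Ccomp; ring. }
  rewrite N1, N2, N3 in HH. clearbody k.
  constructor; unfold j, model_jet; [rewrite HH .. | ].
  1-6: unfold m1, m2, m3, c; Ccomp; field; lra.
  unfold det3, model_v1, model_v2, model_v3. fold a b.
  transitivity (Cmul Ci (RtoC (8 * k ^ 3 * (a * b) * r * ((m3 - m2) * (m2 - m1) * (m3 - m1))))).
  - Ccomp; ring.
  - replace ((m3 - m2) * (m2 - m1) * (m3 - m1)) with (d ^ 3 * s ^ 2)
      by (rewrite Es; unfold m1, m2, m3; field).
    rewrite ND. Ccomp; ring.
Qed.

(** * Equivalence with the model curve and the periodicity criterion *)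

Lemma matvec_add A u v : matvec A (C3add u v) = C3add (matvec A u) (matvec A v).
Proof. apply C3_eq; simpl; ring. Qed.
Lemma matvec_scale A a v : matvec A (C3scale a v) = C3scale a (matvec A v).
Proof. apply C3_eq; simpl; ring. Qed.

Lemma component_matvec A c m m' m'' g0 g1 g2 :
  matvec A (component c m m' m'' g0 g1 g2) =
  component c m m' m'' (matvec A g0) (matvec A g1) (matvec A g2).
Proof. unfold component, eigenvec. rewrite !matvec_scale, !matvec_add, !matvec_scale. reflexivity. Qed.

(** The spectral projections undo the mixing in the jet, since each annihilates the other two
    eigenvectors. *)
Lemma component_model k r c m1 m2 m3 : roots c m1 m2 m3 ->
  let j := model_jet k r m1 m2 m3 in
  component c m1 m2 m3 (j 0%nat) (j 1%nat) (j 2%nat) = model_v1 k r /\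
  component c m2 m1 m3 (j 0%nat) (j 1%nat) (j 2%nat) = model_v2 k r /\
  component c m3 m1 m2 (j 0%nat) (j 1%nat) (j 2%nat) = model_v3 k r.
Proof.
  intros [S P Q n12 n23 n13] j. assert (m3 = - m1 - m2) by lra. subst m3.
  assert (2 * c = m1 ^ 2 + m1 * m2 + m2 ^ 2) as Hc by nra.
  unfold component, eigenvec, j, model_jet. rewrite Hc.
  repeat split; apply C3_eq; simpl;
  Ccomp; field; repeat split; lra.
Qed.

Lemma diffeo_scale a : a <> 0 -> diffeoR (fun t => a * t).
Proof.
  intros Ha.
  exists (fun k => match k with 0%nat => fun t => a * t | 1%nat => fun _ => a | _ => fun _ => 0 end).
  split; [|split; [reflexivity|split; [intros; exact Ha|]]].
  - intros [|[|k]] t.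
    + pose proof (derivable_pt_lim_scal id a t 1 (derivable_pt_lim_id t)) as X.
      rewrite Rmult_1_r in X. exact X.
    + apply derivable_pt_lim_const.
    + apply derivable_pt_lim_const.
  - intros s. exists (s / a). split; [field; exact Ha|].
    intros t <-. field; exact Ha.
Qed.

Lemma gtilde_polar q t : 0 < rfun q ->
  let r := rfun q in let D := 4 + r ^ 4 + (4 - r ^ 4) * cos t in D <> 0 ->
  mkC (px (gtilde q t)) (py (gtilde q t)) =
    Cmul (RtoC (2 * r / D)) (Cmul (expi (q * t))
      (Cadd (RtoC (2 + r ^ 2)) (Cmul (RtoC (2 - r ^ 2)) (expi t)))) /\
  pz (gtilde q t) = (r ^ 4 - 4) * sin t / D.
Proof.
  intros Hr r D HD. unfold gtilde, rotz, eta. fold r. cbv zeta. fold D.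
  split; [|reflexivity]. clearbody D. Ccomp; field; exact HD.
Qed.

Lemma eta_denominator_pos r t : 0 < r -> r ^ 2 < 2 -> 0 < 4 + r ^ 4 + (4 - r ^ 4) * cos t.
Proof.
  intros Hr Hr2. pose proof (COS_bound t) as [a b].
  assert (0 < r ^ 2) by (apply pow_lt; exact Hr).
  assert (0 < r ^ 4) by (apply pow_lt; exact Hr).
  assert (r ^ 4 < 4) by (replace (r ^ 4) with (r ^ 2 * r ^ 2) by ring; nra).
  nra.
Qed.

Lemma gtilde_rho2 q t : 0 < rfun q -> rfun q ^ 2 < 2 ->
  let r := rfun q in let D := 4 + r ^ 4 + (4 - r ^ 4) * cos t in
  px (gtilde q t) ^ 2 + py (gtilde q t) ^ 2 = 8 * r ^ 2 / D.
Proof.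
  intros Hr Hr2 r D. pose proof (eta_denominator_pos r t Hr Hr2) as HD. fold D in HD.
  destruct (gtilde_polar q t Hr) as [E _]; [fold r D; lra|]. fold r D in E.
  transitivity (Cnorm2 (mkC (px (gtilde q t)) (py (gtilde q t)))); [reflexivity|].
  rewrite E. clear E.
  transitivity ((2 * r / D) ^ 2 * Cnorm2 (expi (q * t)) *
    Cnorm2 (Cadd (RtoC (2 + r ^ 2)) (Cmul (RtoC (2 - r ^ 2)) (expi t)))).
  { unfold Cnorm2; simpl; ring. }
  rewrite expi_norm2.
  replace (Cnorm2 (Cadd (RtoC (2 + r ^ 2)) (Cmul (RtoC (2 - r ^ 2)) (expi t)))) with (2 * D).
  - field; lra.
  - pose proof (sin2_cos2 t) as SC. unfold Rsqr in SC.
    unfold Cnorm2, D; simpl.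
    transitivity ((2 + r ^ 2) ^ 2 + (2 - r ^ 2) ^ 2 * (sin t * sin t + cos t * cos t)
       + 2 * (4 - r ^ 4) * cos t); [rewrite SC|]; ring.
Qed.

(** The squared modulus of [2 + r^2 + (2 - r^2) e^(i t)] is twice the denominator of [eta], so its
    conjugate clears that denominator and leaves pure exponentials of frequencies [q], [0] and
    [-1]. *)
Lemma p_h_inv_gtilde q t : 0 < rfun q -> rfun q ^ 2 < 2 ->
  let r := rfun q in
  C3scale (Cconj (Cadd (RtoC (2 + r ^ 2)) (Cmul (RtoC (2 - r ^ 2)) (expi t))))
    (p_h_inv (gtilde q t)) =
  mkC3 (Cadd (RtoC (2 + r ^ 2)) (Cmul (RtoC (2 - r ^ 2)) (expi (- t))))
    (Cmul (RtoC (4 * r)) (expi (q * t)))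
    (Cmul Ci (Csub (RtoC (2 + r ^ 2)) (Cmul (RtoC (2 - r ^ 2)) (expi (- t))))).
Proof.
  intros Hr Hr2 r. pose proof (eta_denominator_pos r t Hr Hr2) as HD.
  set (D := 4 + r ^ 4 + (4 - r ^ 4) * cos t) in *.
  destruct (gtilde_polar q t Hr) as [E Ez]; [fold r D; lra|]. fold r D in E, Ez.
  pose proof (gtilde_rho2 q t Hr Hr2) as Er. cbv zeta in Er. fold r D in Er.
  pose proof (sin2_cos2 t) as SC. unfold Rsqr in SC.
  apply C3_eq; unfold p_h_inv; cbn [C3scale z1 z2 z3].
  - rewrite <- expi_conj. Ccomp; ring.
  - rewrite E.
    set (u := Cadd (RtoC (2 + r ^ 2)) (Cmul (RtoC (2 - r ^ 2)) (expi t))).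
    transitivity (Cmul (RtoC (2 * r / D)) (Cmul (Cmul (Cconj u) u) (expi (q * t)))); [ring|].
    rewrite conj_mul_self.
    replace (Cnorm2 u) with (2 * D).
    + transitivity (Cmul (RtoC (2 * r / D * (2 * D))) (expi (q * t))).
      * Ccomp; ring.
      * replace (2 * r / D * (2 * D)) with (4 * r) by (field; lra). reflexivity.
    + unfold Cnorm2, u, D; simpl.
      transitivity ((2 + r ^ 2) ^ 2 + (2 - r ^ 2) ^ 2 * (sin t * sin t + cos t * cos t)
         + 2 * (4 - r ^ 4) * cos t); [rewrite SC|]; ring.
  - rewrite Er, Ez, <- expi_conj. clear E Er Ez.
    apply C_eq; cbn [re im Cmul Cconj Cadd Csub Copp RtoC expi Ci].
    + transitivity (- (2 - r ^ 2) * sin t * D / D); [unfold D at 3|field; lra].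
      field; lra.
    + transitivity ((2 + r ^ 2 - (2 - r ^ 2) * cos t) * D / D); [|field; lra].
      replace ((2 + r ^ 2 - (2 - r ^ 2) * cos t) * D) with
        (4 * r ^ 2 * (2 + r ^ 2 + (2 - r ^ 2) * cos t)
         + (2 + r ^ 2) * (2 - r ^ 2) ^ 2 * (sin t * sin t)).
      * field; lra.
      * replace (sin t * sin t) with (1 - cos t * cos t) by lra. unfold D. ring.
Qed.

Lemma cr_equiv_model {Gam c} (N : natural_lift Gam c) q : 1 < q -> c = cfun q ->
  cr_equiv (Gam 0%nat) (fun t => p_h_inv (gtilde q t)).
Proof.
  intros Hq Ec. destruct (rfun_spec q Hq) as (Hr & Hr2 & Er). set (r := rfun q) in *.
  destruct (roots_of_cfun q Hq) as (d & Hd & R). rewrite <- Ec in R.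
  set (s := sqrt (q * (q + 1))).
  assert (0 < s) as Hs by (apply sqrt_lt_R0; nra).
  assert (s ^ 2 = q * (q + 1)) as Es by (simpl; rewrite Rmult_1_r; apply sqrt_sqrt; nra).
  pose proof (model_frame q d r s Hd ltac:(lra) Hr Hr2 Hs Es Er) as F. cbv zeta in F.
  assert (d ^ 2 * (q ^ 2 + q + 1) / 6 = c) as Ec2 by (pose proof (r_sq _ _ _ _ R); nra).
  rewrite Ec2 in F.
  pose proof (component_model (/ (4 * d * r * s)) r c _ _ _ R) as V. cbv zeta in V.
  set (k := / (4 * d * r * s)) in *.
  assert (0 < k) as Hk by (apply Rinv_0_lt_compat; repeat apply Rmult_lt_0_compat; lra).
  clearbody k.
  set (m1 := - (d * (2 * q + 1) / 3)) in *. set (m2 := d * (q - 1) / 3) in *.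
  set (m3 := d * (q + 2) / 3) in *.
  destruct (frame_mat_spec (lift_frame N 0) F) as (HG & A0 & A1 & A2).
  set (A := frame_mat _ _ _ _ _ _ _) in *.
  (* This rescaling sends the frequencies [m1], [m2], [m3] to [q], [0], [-1], all shifted by
     [- (q - 1) / 3]. *)
  exists A, (fun t => - (1 / d) * t).
  split; [exact HG|]. split.
  { apply diffeo_scale. assert (0 < 1 / d) by (apply Rdiv_lt_0_compat; lra). lra. }
  intros t. pose proof (lift_solution N m1 m2 m3 R (- (1 / d) * t)) as S. cbv zeta in S.
  set (u := Cadd (RtoC (2 + r ^ 2)) (Cmul (RtoC (2 - r ^ 2)) (expi t))).
  split.
  { intros Z. apply (f_equal (fun z => re (z1 z))) in Z. simpl in Z. lra. }
  (* The exponential accounts for the common frequency shift, [Cconj u] for the denominators, and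
     [- i k] for the scale of the eigenvectors. *)
  exists (Cmul (Cmul (RtoC k) (Copp Ci)) (Cmul (expi (- ((q - 1) / 3 * t))) (Cconj u))).
  split.
  { intros Z. apply Cmul_integral in Z as [Z|Z].
    - apply (f_equal im) in Z. simpl in Z. lra.
    - apply Cmul_integral in Z as [Z|Z]; [exact (expi_neq0 _ Z)|].
      pose proof (f_equal re Z) as Zr. pose proof (f_equal im Z) as Zi. unfold u in Zr, Zi.
      simpl in Zr, Zi. pose proof (sin2_cos2 t) as SC. unfold Rsqr in SC.
      assert (0 < r ^ 2) by (apply pow_lt; exact Hr).
      assert (0 < (2 + r ^ 2) + (2 - r ^ 2) * cos t).
      { pose proof (COS_bound t). nra. }
      simpl in *. lra. }
  rewrite S, !matvec_add, !matvec_scale, !component_matvec, A0, A1, A2.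
  destruct V as (V1 & V2 & V3). rewrite V1, V2, V3.
  transitivity (C3scale (Cmul (Cmul (RtoC k) (Copp Ci)) (expi (- ((q - 1) / 3 * t))))
    (C3scale (Cconj u) (p_h_inv (gtilde q t)))).
  2:{ apply C3_eq; simpl; ring. }
  unfold u, r. rewrite p_h_inv_gtilde by assumption. fold r.
  replace (m1 * (- (1 / d) * t)) with (- ((q - 1) / 3 * t) + q * t) by (unfold m1; field; lra).
  replace (m2 * (- (1 / d) * t)) with (- ((q - 1) / 3 * t)) by (unfold m2; field; lra).
  replace (m3 * (- (1 / d) * t)) with (- ((q - 1) / 3 * t) + - t) by (unfold m3; field; lra).
  rewrite !expi_add. unfold model_v1, model_v2, model_v3.
  set (e := expi (- ((q - 1) / 3 * t))). set (e' := expi (- t)). set (e'' := expi (q * t)).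
  clearbody e e' e''. apply C3_eq; cbn [C3add C3scale z1 z2 z3]; Ccomp; ring.
Qed.

Lemma cfun_periodic {Gam c} (N : natural_lift Gam c) (a b : Z) : (0 < b)%Z ->
  1 < IZR a / IZR b -> c = cfun (IZR a / IZR b) -> periodic_curve (Gam 0%nat).
Proof.
  intros Hb Hq Ec. destruct (roots_of_cfun _ Hq) as (d & Hd & R). rewrite <- Ec in R.
  apply IZR_lt in Hb. pose proof PI_RGT_0 as HPI.
  (* The frequency gaps are [d q] and [d]; over this time they produce [a] and [b] full turns. *)
  assert (0 < 2 * PI * IZR b / d) as HT by (apply Rdiv_lt_0_compat; nra).
  apply (periodic_of_expi N _ _ _ (2 * PI * IZR b / d) R HT).
  - match goal with |- _ = expi (?m * ?T) => transitivity (Cmul (expi (m * T)) (expi (2 * PI * IZR (- a)))) end.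
    + rewrite <- expi_add. f_equal. rewrite opp_IZR. field. lra.
    + rewrite expi_2PI_Z. ring.
  - match goal with |- expi (?m * ?T) = _ => transitivity (Cmul (expi (m * T)) (expi (2 * PI * IZR b))) end.
    + rewrite expi_2PI_Z. ring.
    + rewrite <- expi_add. f_equal. field. lra.
Qed.

Lemma periodic_iff {Gam c} (N : natural_lift Gam c) :
  periodic_curve (Gam 0%nat) <-> exists q : Q, 1 < Q2R q /\ c = cfun (Q2R q).
Proof.
  split.
  - intros HP. destruct (exists_neg_cubic_root c) as (w & Hw & Ew).
    destruct (Rle_lt_dec (w ^ 3) 4) as [L|L]; [destruct (no_period N w Hw Ew L HP)|].
    destruct (roots_of_large_w c w Hw Ew L) as (m2 & m3 & H2 & H3 & R).
    destruct (cfun_of_roots c _ m2 m3 H2 H3 R) as [Hq Ec].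
    destruct (periodic_commensurable N _ _ _ R HP) as (T & k1 & k2 & HT & E1 & E2).
    pose proof PI_RGT_0 as HPI.
    assert (0 < IZR k2) as Hk2.
    { apply Rmult_lt_reg_l with (2 * PI); [lra|]. rewrite <- E2, Rmult_0_r. nra. }
    assert (0 < k2)%Z as Hk2' by (apply lt_IZR; exact Hk2).
    (* Over one period the two frequency gaps make [k1] and [k2] full turns, so their ratio is
       [k1 / k2]. *)
    exists (k1 # Z.to_pos k2).
    assert (Q2R (k1 # Z.to_pos k2) = (m2 - - w) / (m3 - m2)) as ->.
    { unfold Q2R. simpl. rewrite Z2Pos.id by exact Hk2'.
      assert (IZR k1 = (m2 - - w) * T / (2 * PI)) as -> by (rewrite E1; field; lra).
      assert (IZR k2 = (m3 - m2) * T / (2 * PI)) as -> by (rewrite E2; field; lra).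
      field. repeat split; nra. }
    split; assumption.
  - intros (q & Hq & Ec). unfold Q2R in Hq, Ec.
    apply (cfun_periodic N (Qnum q) (Z.pos (Qden q))); [reflexivity|exact Hq|exact Ec].
Qed.

(** * The ambient isotopy *)

(** Joint continuity in time and position, for all real times: one calculus then serves isotopies,
    single homeomorphisms and curves. *)
Definition cts (f : R -> R3 -> R) : Prop :=
  forall s x eps, 0 < eps -> exists del, 0 < del /\
    forall s' y, Rabs (s - s') < del -> dist3 x y < del -> Rabs (f s x - f s' y) < eps.

Lemma cts_const a : cts (fun _ _ => a).
Proof.
  intros s x eps He. exists 1. split; [lra|]. intros. rewrite Rminus_diag, Rabs_R0. exact He.
Qed.
Lemma cts_time : cts (fun s _ => s).
Proof. intros s x eps He. exists eps. auto. Qed.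

Lemma dist3_bound x y : Rabs (px x - px y) <= dist3 x y /\
  Rabs (py x - py y) <= dist3 x y /\ Rabs (pz x - pz y) <= dist3 x y.
Proof.
  unfold dist3.
  pose proof (pow2_ge_0 (px x - px y)); pose proof (pow2_ge_0 (py x - py y));
  pose proof (pow2_ge_0 (pz x - pz y)).
  repeat split; rewrite <- sqrt_Rsqr_abs; apply sqrt_le_1_alt; unfold Rsqr; lra.
Qed.
Lemma cts_px : cts (fun _ x => px x).
Proof.
  intros s x eps He. exists eps. split; [exact He|]. intros s' y _ H.
  pose proof (dist3_bound x y). lra.
Qed.
Lemma cts_py : cts (fun _ x => py x).
Proof.
  intros s x eps He. exists eps. split; [exact He|]. intros s' y _ H.
  pose proof (dist3_bound x y). lra.
Qed.
Lemma cts_pz : cts (fun _ x => pz x).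
Proof.
  intros s x eps He. exists eps. split; [exact He|]. intros s' y _ H.
  pose proof (dist3_bound x y). lra.
Qed.
Lemma cts_plus f g : cts f -> cts g -> cts (fun s x => f s x + g s x).
Proof.
  intros Hf Hg s x eps He.
  destruct (Hf s x (eps / 2)) as (d & Hd & Df); [lra|].
  destruct (Hg s x (eps / 2)) as (d' & Hd' & Dg); [lra|].
  exists (Rmin d d'). split; [apply Rmin_glb_lt; assumption|]. intros s' y H1 H2.
  pose proof (Rmin_l d d'). pose proof (Rmin_r d d').
  specialize (Df s' y ltac:(lra) ltac:(lra)). specialize (Dg s' y ltac:(lra) ltac:(lra)).
  replace (f s x + g s x - (f s' y + g s' y)) with ((f s x - f s' y) + (g s x - g s' y)) by ring.
  eapply Rle_lt_trans; [apply Rabs_triang|]. lra.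
Qed.
Lemma cts_comp g f : (forall s x, continuity_pt g (f s x)) -> cts f -> cts (fun s x => g (f s x)).
Proof.
  intros Hg Hf s x eps He.
  destruct (Hg s x eps He) as (d & Hd & Dg). destruct (Hf s x d Hd) as (d' & Hd' & Df).
  exists d'. split; [exact Hd'|]. intros s' y H1 H2. specialize (Df s' y H1 H2).
  destruct (Req_dec (f s x) (f s' y)) as [E|E].
  - rewrite E, Rminus_diag, Rabs_R0. exact He.
  - rewrite Rabs_minus_sym. apply (Dg (f s' y)). split; [split; [exact I|exact E]|].
    simpl. unfold Rdist. rewrite Rabs_minus_sym. exact Df.
Qed.
Lemma cts_opp f : cts f -> cts (fun s x => - f s x).
Proof.
  apply (cts_comp Ropp). intros. apply derivable_continuous_pt. reg.
Qed.
Lemma cts_minus f g : cts f -> cts g -> cts (fun s x => f s x - g s x).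
Proof. intros Hf Hg. apply cts_plus; [|apply cts_opp]; assumption. Qed.
Lemma cts_ext f g : (forall s x, f s x = g s x) -> cts f -> cts g.
Proof.
  intros E H s x eps He. destruct (H s x eps He) as (d & Hd & K). exists d.
  split; [exact Hd|]. intros s' y. rewrite <- !E. apply K.
Qed.
(** Polarization reduces the product to squares of the sum and the difference. *)
Lemma cts_mult f g : cts f -> cts g -> cts (fun s x => f s x * g s x).
Proof.
  intros Hf Hg.
  apply (cts_ext (fun s x => (f s x + g s x) ^ 2 / 4 - (f s x - g s x) ^ 2 / 4)).
  { intros. field. }
  assert (forall t, continuity_pt (fun u => u ^ 2 / 4) t) as K
    by (intros; apply derivable_continuous_pt; reg).
  apply cts_minus; apply (cts_comp (fun u => u ^ 2 / 4)); auto using cts_plus, cts_minus.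
Qed.
Lemma cts_inv f : (forall s x, f s x <> 0) -> cts f -> cts (fun s x => / f s x).
Proof.
  intros Hf. apply (cts_comp Rinv). intros s x.
  apply (continuity_pt_inv id); [apply derivable_continuous_pt, derivable_pt_id|apply Hf].
Qed.
Lemma cts_div f g : (forall s x, g s x <> 0) -> cts f -> cts g -> cts (fun s x => f s x / g s x).
Proof. intros H Hf Hg. apply cts_mult; [exact Hf|apply cts_inv; assumption]. Qed.
Lemma cts_sqr f : cts f -> cts (fun s x => f s x ^ 2).
Proof. apply (cts_comp (fun u => u ^ 2)). intros. apply derivable_continuous_pt; reg. Qed.
Lemma cts_cos f : cts f -> cts (fun s x => cos (f s x)).
Proof. apply cts_comp. intros. apply continuity_cos. Qed.
Lemma cts_sin f : cts f -> cts (fun s x => sin (f s x)).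
Proof. apply cts_comp. intros. apply continuity_sin. Qed.
Lemma cts_atan f : cts f -> cts (fun s x => atan (f s x)).
Proof. apply cts_comp. intros. apply derivable_continuous_pt, derivable_pt_atan. Qed.
Lemma cts_sqrt f : (forall s x, 0 <= f s x) -> cts f -> cts (fun s x => sqrt (f s x)).
Proof. intros H. apply cts_comp. intros. apply continuity_pt_sqrt, H. Qed.
Lemma cts_Rmax f a : cts f -> cts (fun s x => Rmax (f s x) a).
Proof.
  apply (cts_comp (fun u => Rmax u a)). intros s x eps He. exists eps. split; [exact He|].
  intros y [_ H]. simpl in *. unfold Rdist in *. apply Rabs_def2 in H. apply Rabs_def1;
  unfold Rmax; destruct (Rle_dec y a), (Rle_dec (f s x) a); lra.
Qed.

Ltac cts_tac := repeat first
  [ assumption | apply cts_const | apply cts_time | apply cts_px | apply cts_py | apply cts_pz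
  | apply cts_plus | apply cts_minus | apply cts_opp | apply cts_mult | apply cts_sqr
  | apply cts_cos | apply cts_sin | apply cts_atan | apply cts_Rmax
  | apply cts_div | apply cts_inv | apply cts_sqrt ].

Lemma cts_joint H : cts (fun s x => px (H s x)) -> cts (fun s x => py (H s x)) ->
  cts (fun s x => pz (H s x)) -> forall s x eps, 0 < eps -> exists del, 0 < del /\
    forall s' y, Rabs (s - s') < del -> dist3 x y < del -> dist3 (H s x) (H s' y) < eps.
Proof.
  intros Hx Hy Hz s x eps He.
  (* Three coordinate errors below [eps / 2] suffice, because [3 (eps / 2)^2 < eps^2]. *)
  destruct (Hx s x (eps / 2)) as (d1 & P1 & D1); [lra|].
  destruct (Hy s x (eps / 2)) as (d2 & P2 & D2); [lra|].
  destruct (Hz s x (eps / 2)) as (d3 & P3 & D3); [lra|].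
  exists (Rmin d1 (Rmin d2 d3)). split; [repeat apply Rmin_glb_lt; assumption|].
  intros s' y H1 H2.
  pose proof (Rmin_l d1 (Rmin d2 d3)). pose proof (Rmin_r d1 (Rmin d2 d3)).
  pose proof (Rmin_l d2 d3). pose proof (Rmin_r d2 d3).
  specialize (D1 s' y ltac:(lra) ltac:(lra)). specialize (D2 s' y ltac:(lra) ltac:(lra)).
  specialize (D3 s' y ltac:(lra) ltac:(lra)).
  unfold dist3. rewrite <- (sqrt_pow2 eps) by lra.
  apply Rabs_def2 in D1. apply Rabs_def2 in D2. apply Rabs_def2 in D3.
  apply sqrt_lt_1_alt. split; [|nra].
  pose proof (pow2_ge_0 (px (H s x) - px (H s' y))); pose proof (pow2_ge_0 (py (H s x) - py (H s' y)));
  pose proof (pow2_ge_0 (pz (H s x) - pz (H s' y))). lra.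
Qed.

Lemma cts_cont3 F : cts (fun _ x => px (F x)) -> cts (fun _ x => py (F x)) ->
  cts (fun _ x => pz (F x)) -> cont3 F.
Proof.
  intros Hx Hy Hz x eps He.
  destruct (cts_joint (fun _ => F) Hx Hy Hz 0 x eps He) as (d & Hd & K).
  exists d. split; [exact Hd|]. intros y. apply (K 0). rewrite Rminus_diag, Rabs_R0. exact Hd.
Qed.

Lemma dist3_refl x : dist3 x x = 0.
Proof. unfold dist3. rewrite !Rminus_diag. replace (_ + _ + _) with 0 by ring. apply sqrt_0. Qed.

Lemma cts_continuity f : cts (fun s _ => f s) -> continuity f.
Proof.
  intros H t eps He. destruct (H t (mkR3 0 0 0) eps He) as (d & Hd & K).
  exists d. split; [exact Hd|]. intros y [_ Hy]. simpl in *. unfold Rdist in *.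
  rewrite Rabs_minus_sym. apply (K y (mkR3 0 0 0)).
  - rewrite Rabs_minus_sym. exact Hy.
  - rewrite dist3_refl. exact Hd.
Qed.

Lemma continuity_cts f : cts (fun _ x => f (px x)) -> continuity f.
Proof.
  intros H t eps He. destruct (H 0 (mkR3 t 0 0) eps He) as (d & Hd & K).
  exists d. split; [exact Hd|]. intros y [_ Hy]. simpl in *. unfold Rdist in *.
  rewrite Rabs_minus_sym. apply (K 0 (mkR3 y 0 0)).
  - rewrite Rminus_diag, Rabs_R0. exact Hd.
  - unfold dist3; simpl. rewrite Rminus_diag.
    replace (_ + _ + _) with (Rsqr (t - y)) by (unfold Rsqr; ring).
    rewrite sqrt_Rsqr_abs, Rabs_minus_sym. exact Hy.
Qed.

Lemma cont3_comp f g : cont3 f -> cont3 g -> cont3 (fun x => g (f x)).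
Proof.
  intros Hf Hg x eps He. destruct (Hg (f x) eps He) as (d & Hd & K).
  destruct (Hf x d Hd) as (d' & Hd' & K'). exists d'. auto.
Qed.
Lemma homeo3_comp f g : homeo3 f -> homeo3 g -> homeo3 (fun x => g (f x)).
Proof.
  intros (f' & a & b & d & e) (g' & a' & b' & d' & e'). exists (fun y => f' (g' y)).
  split; [|split; [|split]].
  - intros x. rewrite a'. apply a.
  - intros y. rewrite b. apply b'.
  - apply cont3_comp; assumption.
  - apply (cont3_comp g' f'); assumption.
Qed.

(** By monotonicity the interval from [F (G u - eps)] to [F (G u + eps)] is a neighbourhood of [u]
    mapped by [G] within [eps] of [G u]. Surjectivity is given as data, so [G] is obtained by
    projection. *)
Lemma increasing_bijection_inverse (F : R -> R) : (forall x y, x < y -> F x < F y) ->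
  (forall u, {x | F x = u}) ->
  exists G, continuity G /\ (forall u, F (G u) = u) /\ (forall x, G (F x) = x).
Proof.
  intros Hi Hs. set (G := fun u => proj1_sig (Hs u)).
  assert (forall u, F (G u) = u) as FG by (intros u; apply (proj2_sig (Hs u))).
  assert (forall x y, F x < F y -> x < y) as Hr.
  { intros x y H. destruct (Rlt_le_dec x y) as [L|[L|L]]; [exact L| |].
    - apply Hi in L. lra.
    - subst. lra. }
  exists G. split; [|split; [exact FG|]].
  - intros u eps He.
    assert (F (G u - eps) < u) as A by (rewrite <- (FG u) at 2; apply Hi; lra).
    assert (u < F (G u + eps)) as B by (rewrite <- (FG u) at 1; apply Hi; lra).
    exists (Rmin (u - F (G u - eps)) (F (G u + eps) - u)).
    split; [apply Rmin_glb_lt; lra|]. intros v [_ Hv]. simpl in *. unfold Rdist in *.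
    pose proof (Rmin_l (u - F (G u - eps)) (F (G u + eps) - u)).
    pose proof (Rmin_r (u - F (G u - eps)) (F (G u + eps) - u)).
    apply Rabs_def2 in Hv.
    assert (G u - eps < G v) by (apply Hr; rewrite FG; lra).
    assert (G v < G u + eps) by (apply Hr; rewrite FG; lra).
    apply Rabs_def1; lra.
  - intros x. destruct (Rtotal_order (G (F x)) x) as [L|[L|L]]; [|exact L|];
    apply Hi in L; rewrite FG in L; lra.
Qed.

(* [rho |-> rho * radial_factor r a rho] is [rho / r] for [rho <= r] and
   [1 + (rho^2 - r^2) / a] for [rho >= r]. *)
Definition radial_factor (r a rho : R) : R :=
  (1 + (Rmax rho r ^ 2 - r ^ 2) / a) / Rmax rho r.
Definition radial_factor_at (r a s rho : R) : R := (1 - s) + s * radial_factor r a rho.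

Lemma Rmax_pos rho r : 0 < r -> 0 < Rmax rho r.
Proof. intros H. pose proof (Rmax_r rho r). lra. Qed.

Lemma radial_low r a rho : 0 < r -> rho <= r -> rho * radial_factor r a rho = rho / r.
Proof.
  intros Hr H. unfold radial_factor. rewrite Rmax_right by exact H.
  replace ((r ^ 2 - r ^ 2) / a) with 0 by (unfold Rdiv; ring). field. lra.
Qed.
Lemma radial_high r a rho : 0 < r -> r <= rho ->
  rho * radial_factor r a rho = 1 + (rho ^ 2 - r ^ 2) / a.
Proof.
  intros Hr H. unfold radial_factor. rewrite Rmax_left by exact H.
  generalize ((rho ^ 2 - r ^ 2) / a). intros v. field. lra.
Qed.

Lemma radial_factor_pos r a rho : 0 < r -> 0 < a -> 0 < radial_factor r a rho.
Proof.
  intros Hr Ha. unfold radial_factor. pose proof (Rmax_r rho r).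
  assert (0 <= (Rmax rho r ^ 2 - r ^ 2) / a).
  { apply Rmult_le_pos; [nra|]. apply Rlt_le, Rinv_0_lt_compat; exact Ha. }
  apply Rdiv_lt_0_compat; lra.
Qed.
Lemma radial_factor_at_pos r a s rho : 0 < r -> 0 < a -> 0 <= s <= 1 ->
  0 < radial_factor_at r a s rho.
Proof.
  intros Hr Ha Hs. unfold radial_factor_at. pose proof (radial_factor_pos r a rho Hr Ha).
  destruct (Req_dec s 0); nra.
Qed.

Lemma radial_increasing r a x y : 0 < r -> 0 < a -> x < y ->
  x * radial_factor r a x < y * radial_factor r a y.
Proof.
  intros Hr Ha H.
  assert (0 < / a) by (apply Rinv_0_lt_compat; exact Ha).
  assert (0 < / r) by (apply Rinv_0_lt_compat; exact Hr).
  destruct (Rle_lt_dec y r) as [Y|Y].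
  - rewrite !radial_low by lra. unfold Rdiv. nra.
  - rewrite (radial_high r a y) by lra.
    assert (0 < (y ^ 2 - r ^ 2) / a) by (apply Rmult_lt_0_compat; [nra|assumption]).
    destruct (Rle_lt_dec x r) as [X|X].
    + rewrite radial_low by assumption.
      assert (x / r <= 1).
      { apply Rmult_le_reg_r with r; [exact Hr|]. unfold Rdiv. rewrite Rmult_assoc, Rinv_l; lra. }
      lra.
    + rewrite radial_high by lra. unfold Rdiv.
      assert ((x ^ 2 - r ^ 2) * / a < (y ^ 2 - r ^ 2) * / a); [|lra].
      apply Rmult_lt_compat_r; [assumption|nra].
Qed.

Lemma cts_radial r a s f : 0 < r -> cts s -> cts f ->
  cts (fun t x => radial_factor_at r a (s t x) (f t x)).
Proof.
  intros Hr Hs Hf. unfold radial_factor_at, radial_factor.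
  assert (forall t x, Rmax (f t x) r <> 0) as Hm
    by (intros; apply Rgt_not_eq, Rmax_pos; exact Hr).
  unfold Rdiv at 2.
  apply cts_plus; [cts_tac|]. apply cts_mult; [assumption|].
  apply cts_div; [exact Hm| |cts_tac].
  cts_tac.
Qed.

(** [F] interpolates linearly between two increasing maps. Letting it act on negative radii as well
    makes it a bijection of the whole line. *)
Lemma radial_inverse r a s : 0 < r -> 0 < a -> 0 <= s <= 1 ->
  let F x := x * radial_factor_at r a s x in
  exists G, continuity G /\ (forall u, F (G u) = u) /\ (forall x, G (F x) = x).
Proof.
  intros Hr Ha Hs F.
  assert (forall x, F x = (1 - s) * x + s * (x * radial_factor r a x)) as FE
    by (intros; unfold F, radial_factor_at; ring).
  apply increasing_bijection_inverse.
  - intros x y H. rewrite !FE. pose proof (radial_increasing r a x y Hr Ha H).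
    destruct (Req_dec s 0); nra.
  (* [M] dominates [|u|] and [r |u|], and [M^2 - r^2] dominates [a |u|], so both interpolated maps
     cross the level [u] on [[- M, M]]. *)
  - intros u. set (X := 1 + Rabs u * (1 + r + a)). set (M := r + X).
    pose proof (Rabs_pos u) as Hu.
    assert (0 <= Rabs u * r) by nra. assert (0 <= Rabs u * a) by nra.
    assert (X = 1 + Rabs u + Rabs u * r + Rabs u * a) as EX by (unfold X; ring).
    assert (Rabs u <= M * radial_factor r a M) as H1.
    { rewrite radial_high by (unfold M; lra).
      assert (Rabs u <= (M ^ 2 - r ^ 2) / a); [|lra].
      apply Rmult_le_reg_r with a; [exact Ha|]. unfold Rdiv. rewrite Rmult_assoc, Rinv_l by lra.
      unfold M. nra. }
    assert (- M * radial_factor r a (- M) <= - Rabs u) as H2.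
    { rewrite radial_low by (unfold M; lra).
      apply Rmult_le_reg_r with r; [exact Hr|]. unfold Rdiv. rewrite Rmult_assoc, Rinv_l by lra.
      unfold M. lra. }
    destruct (IVT_cor (fun x => F x - u) (- M) M) as (x & _ & Hx).
    + apply continuity_minus; [|apply continuity_const; intros ? ?; reflexivity].
      apply continuity_cts. unfold F. apply cts_mult; [cts_tac|].
      apply (cts_radial r a (fun _ _ => s) (fun _ x => px x)); [exact Hr|cts_tac|cts_tac].
    + unfold M; lra.
    + rewrite !FE. pose proof (Rle_abs u) as P1. pose proof (Rle_abs (- u)) as P2.
      rewrite Rabs_Ropp in P2.
      assert ((1 - s) * - M + s * (- M * radial_factor r a (- M)) - u <= 0).
      { assert (s * (- M * radial_factor r a (- M)) <= s * (- Rabs u)) by (apply Rmult_le_compat_l; lra).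
        assert ((1 - s) * - M <= (1 - s) * (- Rabs u)) by (apply Rmult_le_compat_l; unfold M; lra).
        lra. }
      assert (0 <= (1 - s) * M + s * (M * radial_factor r a M) - u).
      { assert (s * (Rabs u) <= s * (M * radial_factor r a M)) by (apply Rmult_le_compat_l; lra).
        assert ((1 - s) * Rabs u <= (1 - s) * M) by (apply Rmult_le_compat_l; unfold M; lra).
        lra. }
      nra.
    + exists x. lra.
Qed.

Definition rho (p : R3) : R := sqrt (px p ^ 2 + py p ^ 2).
Definition scale_cyl (k l : R) (p : R3) : R3 := mkR3 (k * px p) (k * py p) (l * pz p).

Lemma rho_nonneg p : 0 <= rho p.
Proof. apply sqrt_pos. Qed.
Lemma rho_scale k l p : 0 < k -> rho (scale_cyl k l p) = k * rho p.
Proof.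
  intros Hk. unfold rho, scale_cyl; simpl px; simpl py.
  replace ((k * px p) ^ 2 + (k * py p) ^ 2) with (k ^ 2 * (px p ^ 2 + py p ^ 2)) by ring.
  rewrite sqrt_mult_alt by (apply pow2_ge_0). rewrite sqrt_pow2 by lra. reflexivity.
Qed.
Lemma cts_rho (F : R -> R3 -> R3) : cts (fun s x => px (F s x)) -> cts (fun s x => py (F s x)) ->
  cts (fun s x => rho (F s x)).
Proof.
  intros Hx Hy. unfold rho. apply cts_sqrt.
  - intros. pose proof (pow2_ge_0 (px (F s x))). pose proof (pow2_ge_0 (py (F s x))). lra.
  - cts_tac.
Qed.

Lemma homeo3_radial r a s l : 0 < r -> 0 < a -> 0 <= s <= 1 -> 0 < l ->
  homeo3 (fun p => scale_cyl (radial_factor_at r a s (rho p)) l p).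
Proof.
  intros Hr Ha Hs Hl. destruct (radial_inverse r a s Hr Ha Hs) as (G & GC & FG & GF).
  cbv zeta in FG, GF.
  set (k := radial_factor_at r a s) in *.
  assert (forall x, 0 < k x) as Hk by (intros; apply radial_factor_at_pos; assumption).
  exists (fun p => scale_cyl (/ k (G (rho p))) (/ l) p).
  assert (cts (fun _ p => rho p)) as Cr by (apply (cts_rho (fun _ p => p)); cts_tac).
  assert (cts (fun _ p => k (rho p))) as Ck.
  { apply (cts_radial r a (fun _ _ => s) (fun _ p => rho p)); [exact Hr|cts_tac|exact Cr]. }
  assert (cts (fun _ p => / k (G (rho p)))) as Ck'.
  { apply cts_inv; [intros; apply Rgt_not_eq, Hk|].
    apply (cts_radial r a (fun _ _ => s) (fun _ p => G (rho p))); [exact Hr|cts_tac|].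
    apply (cts_comp G); [|exact Cr]. intros; apply GC. }
  split; [|split; [|split]].
  - intros x. rewrite rho_scale by apply Hk.
    rewrite (Rmult_comm (k (rho x))), GF. pose proof (Hk (rho x)).
    destruct x as [x y z]. unfold scale_cyl. cbn [px py pz]. f_equal; field; lra.
  - intros y. pose proof (Hk (G (rho y))) as P.
    rewrite rho_scale by (apply Rinv_0_lt_compat; exact P).
    assert (/ k (G (rho y)) * rho y = G (rho y)) as ->.
    { rewrite <- (FG (rho y)) at 2. field. lra. }
    destruct y as [x y z]. unfold scale_cyl. cbn [px py pz]. f_equal; field; lra.
  - apply cts_cont3; unfold scale_cyl; cbn [px py pz]; cts_tac.
  - apply cts_cont3; unfold scale_cyl; cbn [px py pz]; cts_tac.
Qed.

(** The angle depends only on rotation invariants, so rotating back by the angle at the image point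
    inverts the map. *)
Lemma homeo3_twist (f : R -> R -> R) : cts (fun _ p => f (px p ^ 2 + py p ^ 2) (pz p)) ->
  homeo3 (fun p => rotz (f (px p ^ 2 + py p ^ 2) (pz p)) p).
Proof.
  intros Hf.
  set (g := fun p => f (px p ^ 2 + py p ^ 2) (pz p)).
  assert (forall th p, px (rotz th p) ^ 2 + py (rotz th p) ^ 2 = px p ^ 2 + py p ^ 2) as I.
  { intros th p. simpl. pose proof (sin2_cos2 th) as S. unfold Rsqr in S.
    transitivity ((px p ^ 2 + py p ^ 2) * (sin th * sin th + cos th * cos th)); [ring|].
    rewrite S; ring. }
  assert (forall th p, rotz (- th) (rotz th p) = p) as J.
  { intros th [x y z]. unfold rotz; simpl. rewrite cos_neg, sin_neg.
    pose proof (sin2_cos2 th) as S. unfold Rsqr in S. f_equal.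
    - transitivity (x * (sin th * sin th + cos th * cos th)); [ring|]. rewrite S; ring.
    - transitivity (y * (sin th * sin th + cos th * cos th)); [ring|]. rewrite S; ring. }
  assert (cts (fun _ p => g p)) as Cg by exact Hf.
  exists (fun p => rotz (- g p) p).
  assert (forall th p, g (rotz th p) = g p) as K.
  { intros th p. unfold g. rewrite I. reflexivity. }
  split; [|split; [|split]].
  - intros x. change (rotz (- g (rotz (g x) x)) (rotz (g x) x) = x). rewrite K. apply J.
  - intros y. change (rotz (g (rotz (- g y) y)) (rotz (- g y) y) = y).
    rewrite K, <- (Ropp_involutive (g y)) at 1. apply J.
  - apply cts_cont3; unfold rotz; cbn [px py pz]; cts_tac.
  - apply cts_cont3; unfold rotz; cbn [px py pz]; cts_tac.
Qed.

(** * The model curve in cylindrical coordinates and its untwisting *)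

Lemma INR_div_gt_1 (m n : nat) : (0 < n)%nat -> (n < m)%nat -> 1 < INR m / INR n.
Proof.
  intros Hn Hm. apply lt_0_INR in Hn. apply lt_INR in Hm.
  apply Rmult_lt_reg_r with (INR n); [exact Hn|]. unfold Rdiv.
  rewrite Rmult_assoc, Rinv_l; lra.
Qed.

Lemma polar_atan u v : 0 < u ->
  mkC u v = Cmul (RtoC (sqrt (u ^ 2 + v ^ 2))) (expi (atan (v / u))).
Proof.
  intros Hu.
  assert (0 < u ^ 2 + v ^ 2) as P by nra.
  assert (sqrt (1 + (v / u)²) = sqrt (u ^ 2 + v ^ 2) / u) as E.
  { rewrite <- (sqrt_pow2 u) at 3 by lra. rewrite <- sqrt_div_alt by nra. f_equal.
    unfold Rsqr. field. lra. }
  pose proof (sqrt_lt_R0 _ P). set (w := sqrt (u ^ 2 + v ^ 2)) in *. clearbody w.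
  apply C_eq; simpl; rewrite ?cos_atan, ?sin_atan, E; field; lra.
Qed.

(** The argument of [2 + r^2 + (2 - r^2) e^(i t)], which stays in the right half-plane when
    [0 < r^2 < 2], so the arctangent is a global continuous branch. *)
Definition phase (r t : R) : R := atan ((2 - r ^ 2) * sin t / (2 + r ^ 2 + (2 - r ^ 2) * cos t)).

Lemma phase_denominator_pos r t : 0 < r -> r ^ 2 < 2 -> 0 < 2 + r ^ 2 + (2 - r ^ 2) * cos t.
Proof.
  intros Hr Hr2. pose proof (COS_bound t). assert (0 < r ^ 2) by (apply pow_lt; exact Hr). nra.
Qed.

Lemma phase_spec r t : 0 < r -> r ^ 2 < 2 -> let D := 4 + r ^ 4 + (4 - r ^ 4) * cos t in
  Cadd (RtoC (2 + r ^ 2)) (Cmul (RtoC (2 - r ^ 2)) (expi t)) =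
  Cmul (RtoC (sqrt (2 * D))) (expi (phase r t)).
Proof.
  intros Hr Hr2 D.
  pose proof (polar_atan _ ((2 - r ^ 2) * sin t) (phase_denominator_pos r t Hr Hr2)) as P.
  fold (phase r t) in P.
  transitivity (mkC (2 + r ^ 2 + (2 - r ^ 2) * cos t) ((2 - r ^ 2) * sin t)).
  - Ccomp; ring.
  - rewrite P. f_equal. f_equal. f_equal.
    pose proof (sin2_cos2 t) as SC. unfold Rsqr in SC. unfold D.
    transitivity ((2 + r ^ 2) ^ 2 + (2 - r ^ 2) ^ 2 * (sin t * sin t + cos t * cos t)
         + 2 * (4 - r ^ 4) * cos t); [|rewrite SC]; ring.
Qed.

(* [t - 2 phase] is the eccentric angle of the conic traced by [(rho^2, z)]. *)
Lemma eccentric_angle r t : 0 < r -> r ^ 2 < 2 -> let D := 4 + r ^ 4 + (4 - r ^ 4) * cos t in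
  cos (t - 2 * phase r t) = ((4 + r ^ 4) * cos t + (4 - r ^ 4)) / D /\
  sin (t - 2 * phase r t) = 4 * r ^ 2 * sin t / D.
Proof.
  intros Hr Hr2 D. pose proof (eta_denominator_pos r t Hr Hr2) as HD. fold D in HD.
  pose proof (phase_spec r t Hr Hr2) as P. cbv zeta in P. fold D in P.
  set (e := expi (phase r t)) in *.
  set (u := Cadd (RtoC (2 + r ^ 2)) (Cmul (RtoC (2 - r ^ 2)) (expi t))) in *.
  assert (sqrt (2 * D) * sqrt (2 * D) = 2 * D) as S by (apply sqrt_sqrt; lra).
  assert (Cmul (RtoC (2 * D)) (expi (t - 2 * phase r t)) = Cmul (expi t) (Cmul (Cconj u) (Cconj u))) as E.
  { rewrite P, conj_mul, conj_RtoC. unfold e. rewrite expi_conj.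
    replace (t - 2 * phase r t) with (t + (- phase r t + - phase r t)) by ring.
    rewrite !expi_add. generalize (expi t) (expi (- phase r t)). revert S.
    generalize (sqrt (2 * D)). intros w S x y. rewrite <- S. Ccomp; ring. }
  pose proof (sin2_cos2 t) as SC. unfold Rsqr in SC.
  pose proof (f_equal re E) as Er. pose proof (f_equal im E) as Ei.
  unfold u in Er, Ei. cbn [re im Cmul Cconj Cadd RtoC expi] in Er, Ei.
  assert (sin t * sin t = 1 - cos t * cos t) as S2 by lra.
  split; apply Rmult_eq_reg_l with (2 * D); try lra.
  - transitivity (2 * ((4 + r ^ 4) * cos t + (4 - r ^ 4))); [|field; lra].
    ring_simplify in Er. ring_simplify.
    replace (sin t ^ 2) with (1 - cos t ^ 2) in Er by (simpl; lra). lra.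
  - transitivity (2 * (4 * r ^ 2 * sin t)); [|field; lra].
    ring_simplify in Ei. ring_simplify.
    replace (sin t ^ 3) with (sin t * (1 - cos t ^ 2)) in Ei by (rewrite <- SC; ring). lra.
Qed.

Lemma phase_eccentric_surjective r : 0 < r -> r ^ 2 < 2 ->
  forall th, exists t, t - 2 * phase r t = th.
Proof.
  intros Hr Hr2 th.
  assert (forall t, - (PI / 2) < phase r t < PI / 2) as B.
  { intros t. pose proof (atan_bound ((2 - r ^ 2) * sin t / (2 + r ^ 2 + (2 - r ^ 2) * cos t))).
    unfold phase. lra. }
  assert (continuity (fun t => t - 2 * phase r t - th)) as C.
  { apply cts_continuity. unfold phase. cts_tac.
    intros s _. apply Rgt_not_eq, phase_denominator_pos; assumption. }
  (* Twice the phase is smaller than [PI <= 4] in absolute value, so the signs at the endpoints are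
     opposite. *)
  destruct (IVT _ (th - 4) (th + 4) C) as (t & _ & Ht).
  - lra.
  - pose proof (B (th - 4)). pose proof PI_4. lra.
  - pose proof (B (th + 4)). pose proof PI_4. lra.
  - exists t. cbv beta in Ht. lra.
Qed.

(** The bound [r <= w], which follows from [D <= 8], places the curve where [radial_high] describes
    the radial map. *)
Lemma gtilde_cyl q t : 0 < rfun q -> rfun q ^ 2 < 2 ->
  let r := rfun q in let D := 4 + r ^ 4 + (4 - r ^ 4) * cos t in
  let w := rho (gtilde q t) in
  w ^ 2 = 8 * r ^ 2 / D /\ r <= w /\
  mkC (px (gtilde q t)) (py (gtilde q t)) = Cmul (RtoC w) (expi (q * t + phase r t)) /\
  pz (gtilde q t) = (r ^ 4 - 4) * sin t / D.
Proof.
  intros Hr Hr2 r D w. pose proof (eta_denominator_pos r t Hr Hr2) as HD. fold D in HD.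
  pose proof (gtilde_rho2 q t Hr Hr2) as E. cbv zeta in E. fold r D in E.
  destruct (gtilde_polar q t Hr) as [P Pz]; [fold r D; lra|]. fold r D in P, Pz.
  assert (0 < r) as Hr' by exact Hr.
  assert (0 < r ^ 2) by (apply pow_lt; exact Hr').
  assert (0 < r ^ 4) by (apply pow_lt; exact Hr').
  assert (r ^ 4 < 4) by (replace (r ^ 4) with (r ^ 2 * r ^ 2) by ring; unfold r in *; nra).
  assert (w ^ 2 = 8 * r ^ 2 / D) as Ew.
  { unfold w, rho. rewrite E. apply pow2_sqrt.
    apply Rlt_le, Rdiv_lt_0_compat; lra. }
  assert (w = 2 * r / D * sqrt (2 * D)) as Ew'.
  { unfold w, rho. rewrite E. apply sqrt_lem_1.
    - apply Rlt_le, Rdiv_lt_0_compat; lra.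
    - apply Rmult_le_pos; [apply Rlt_le, Rdiv_lt_0_compat; lra|apply sqrt_pos].
    - transitivity ((2 * r / D) ^ 2 * (sqrt (2 * D) * sqrt (2 * D))); [ring|].
      rewrite sqrt_sqrt by lra. field; lra. }
  split; [exact Ew|]. split; [|split; [|exact Pz]].
  - assert (r ^ 2 <= w ^ 2).
    { rewrite Ew. apply Rmult_le_reg_r with D; [exact HD|].
      replace (8 * r ^ 2 / D * D) with (8 * r ^ 2) by (field; lra).
      assert (D <= 8) by (unfold D; pose proof (COS_bound t); nra). nra. }
    pose proof (rho_nonneg (gtilde q t)) as W. fold w in W. nra.
  - rewrite P. unfold r at 2 3. rewrite (phase_spec _ t Hr Hr2). fold r D.
    rewrite Ew', expi_add. generalize (expi (q * t)) (expi (phase r t)). intros. Ccomp; ring.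
Qed.

(* On the knot, [atan (2 z / (2 + rho^2))] is minus the phase of the curve point. *)
Definition untwist_angle (q s z : R) : R := q * PI + (2 * q + 1) * atan (2 * z / (2 + s)).

(** With eccentric angle [th], the ellipse is [rho^2 = r^2 + a (1 - cos th)],
    [z = - (a / 2) sin th]. Hence this [a] and the vertical factor [2 / a]: at time 1 the radius
    becomes [2 - cos th] and the height [- sin th]. *)
Definition knot_isotopy (q s : R) (p : R3) : R3 :=
  let r := rfun q in let a := (4 - r ^ 4) / (2 * r ^ 2) in
  let p' := rotz (s * untwist_angle q (px p ^ 2 + py p ^ 2) (pz p)) p in
  scale_cyl (radial_factor_at r a s (rho p')) ((1 - s) + s * (2 / a)) p'.

Lemma knot_radius_pos r : 0 < r -> r ^ 2 < 2 -> 0 < (4 - r ^ 4) / (2 * r ^ 2).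
Proof.
  intros Hr Hr2. assert (0 < r ^ 2) by (apply pow_lt; exact Hr).
  apply Rdiv_lt_0_compat; [|lra].
  replace (r ^ 4) with (r ^ 2 * r ^ 2) by ring. nra.
Qed.

Lemma cts_untwist q : cts (fun _ p => untwist_angle q (px p ^ 2 + py p ^ 2) (pz p)).
Proof.
  unfold untwist_angle. cts_tac. intros _ p.
  pose proof (pow2_ge_0 (px p)). pose proof (pow2_ge_0 (py p)). lra.
Qed.

Lemma knot_isotopy_cts q : 0 < rfun q ->
  cts (fun s p => px (knot_isotopy q s p)) /\ cts (fun s p => py (knot_isotopy q s p)) /\
  cts (fun s p => pz (knot_isotopy q s p)).
Proof.
  intros Hr. pose proof (cts_untwist q) as U. unfold knot_isotopy. cbv zeta.
  set (a := (4 - rfun q ^ 4) / (2 * rfun q ^ 2)).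
  set (p' := fun s p => rotz (s * untwist_angle q (px p ^ 2 + py p ^ 2) (pz p)) p).
  assert (cts (fun s p => px (p' s p))) as Px
    by (unfold p', rotz; cbn [px py pz]; cts_tac).
  assert (cts (fun s p => py (p' s p))) as Py
    by (unfold p', rotz; cbn [px py pz]; cts_tac).
  assert (cts (fun s p => pz (p' s p))) as Pz by (unfold p', rotz; cbn [px py pz]; cts_tac).
  assert (cts (fun s p => radial_factor_at (rfun q) a s (rho (p' s p)))) as K.
  { apply (cts_radial (rfun q) a (fun s _ => s) (fun s p => rho (p' s p)));
    [exact Hr|cts_tac|apply cts_rho; assumption]. }
  unfold scale_cyl; cbn [px py pz].
  split; [|split].
  - apply (cts_mult _ (fun s p => px (p' s p)) K Px).
  - apply (cts_mult _ (fun s p => py (p' s p)) K Py).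
  - apply (cts_mult _ (fun s p => pz (p' s p))); [cts_tac|exact Pz].
Qed.

Lemma knot_isotopy_homeo q s : 0 < rfun q -> rfun q ^ 2 < 2 -> 0 <= s <= 1 ->
  homeo3 (knot_isotopy q s).
Proof.
  intros Hr Hr2 Hs. pose proof (knot_radius_pos _ Hr Hr2) as Ha.
  apply (homeo3_comp (fun p => rotz (s * untwist_angle q (px p ^ 2 + py p ^ 2) (pz p)) p)
    (fun p' => scale_cyl (radial_factor_at _ _ s (rho p')) _ p')).
  - apply (homeo3_twist (fun u z => s * untwist_angle q u z)).
    apply cts_mult; [apply cts_const|apply cts_untwist].
  - apply homeo3_radial; try assumption.
    assert (0 < 2 / ((4 - rfun q ^ 4) / (2 * rfun q ^ 2))) by (apply Rdiv_lt_0_compat; lra).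
    destruct (Req_dec s 0); nra.
Qed.

Lemma knot_isotopy_0 q p : knot_isotopy q 0 p = p.
Proof.
  unfold knot_isotopy, scale_cyl, radial_factor_at, rotz. cbv zeta. cbn [px py pz].
  rewrite !Rmult_0_l, cos_0, sin_0. destruct p as [x y z]. cbn [px py pz]. f_equal; ring.
Qed.

Lemma rotz_expi th p :
  mkC (px (rotz th p)) (py (rotz th p)) = Cmul (mkC (px p) (py p)) (expi th).
Proof. Ccomp; ring. Qed.

Lemma knot_isotopy_1 q t : 0 < rfun q -> rfun q ^ 2 < 2 ->
  let th := t - 2 * phase (rfun q) t in
  knot_isotopy q 1 (gtilde q t) =
  mkR3 ((2 - cos th) * cos (q * th + q * PI)) ((2 - cos th) * sin (q * th + q * PI)) (- sin th).
Proof.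
  intros Hr Hr2 th. pose proof (eta_denominator_pos _ t Hr Hr2) as HD.
  destruct (gtilde_cyl q t Hr Hr2) as (Ew & Hw & P & Pz).
  destruct (eccentric_angle _ t Hr Hr2) as [Ec Es]. fold th in Ec, Es.
  pose proof (knot_radius_pos _ Hr Hr2) as Ha.
  unfold knot_isotopy. cbv zeta in *. set (r := rfun q) in *.
  set (D := 4 + r ^ 4 + (4 - r ^ 4) * cos t) in *.
  set (g := gtilde q t) in *.
  assert (px g ^ 2 + py g ^ 2 = 8 * r ^ 2 / D) as E2 by (apply gtilde_rho2; assumption).
  (* The factorization [D + 4 r^2 = (2 + r^2) (2 + r^2 + (2 - r^2) cos t)] identifies
     [2 z / (2 + rho^2)] with minus the tangent of the phase. Adding this angle turns [q t + phase]
     into [q th + q PI]. *)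
  assert (untwist_angle q (px g ^ 2 + py g ^ 2) (pz g) = q * PI - (2 * q + 1) * phase r t) as EA.
  { rewrite E2, Pz. unfold untwist_angle, phase.
    pose proof (phase_denominator_pos r t Hr Hr2) as HU.
    assert (0 < r ^ 2) by (apply pow_lt; exact Hr).
    replace (2 * ((r ^ 4 - 4) * sin t / D) / (2 + 8 * r ^ 2 / D)) with
      (- ((2 - r ^ 2) * sin t / (2 + r ^ 2 + (2 - r ^ 2) * cos t))).
    - rewrite atan_opp. ring.
    - assert (D + 4 * r ^ 2 = (2 + r ^ 2) * (2 + r ^ 2 + (2 - r ^ 2) * cos t)) as ED by (unfold D; ring).
      transitivity ((r ^ 4 - 4) * sin t / (D + 4 * r ^ 2)).
      + rewrite ED. field. lra.
      + field. lra. }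
  rewrite EA, Rmult_1_l.
  set (p' := rotz (q * PI - (2 * q + 1) * phase r t) g).
  assert (rho p' = rho g) as Er.
  { unfold rho. f_equal. transitivity (Cnorm2 (mkC (px p') (py p'))); [reflexivity|].
    transitivity (Cnorm2 (mkC (px g) (py g))); [|reflexivity].
    unfold p'. rewrite rotz_expi.
    transitivity (Cnorm2 (mkC (px g) (py g)) * Cnorm2 (expi (q * PI - (2 * q + 1) * phase r t))).
    - unfold Cnorm2; simpl; ring.
    - rewrite expi_norm2. ring. }
  set (a := (4 - r ^ 4) / (2 * r ^ 2)) in *.
  assert (rho g * radial_factor r a (rho g) = 2 - cos th) as ER.
  { rewrite radial_high by assumption. rewrite Ew, Ec. unfold a, D. field.
    assert (0 < r ^ 2) by (apply pow_lt; exact Hr). fold D.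
    assert (4 - r ^ 4 = a * (2 * r ^ 2)) by (unfold a; field; lra).
    repeat split; nra. }
  assert (mkC (px p') (py p') = Cmul (RtoC (rho g)) (expi (q * th + q * PI))) as EP.
  { unfold p'. rewrite rotz_expi, P. replace (q * th + q * PI) with
      ((q * t + phase r t) + (q * PI - (2 * q + 1) * phase r t)) by (unfold th; ring).
    rewrite (expi_add (q * t + phase r t)). ring. }
  pose proof (f_equal re EP) as X. pose proof (f_equal im EP) as Y.
  cbn [re im Cmul RtoC expi] in X, Y.
  assert (pz p' = pz g) as Z by reflexivity.
  rewrite Er. unfold scale_cyl, radial_factor_at. fold a.
  rewrite Z, Pz, <- ER.
  assert (0 < r ^ 2) by (apply pow_lt; exact Hr).
  assert (4 - r ^ 4 = a * (2 * r ^ 2)) as Ea by (unfold a; field; lra).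
  f_equal.
  - rewrite X. ring.
  - rewrite Y. ring.
  - rewrite Es. unfold a. field. repeat split; nra.
Qed.

Lemma gtilde_ambient_isotopic (m n : nat) : (0 < n)%nat -> (n < m)%nat ->
  ambient_isotopic (image (gtilde (INR m / INR n)))
    (image (std_torus_knot (- Z.of_nat m) (Z.of_nat n))).
Proof.
  intros Hn Hm. set (q := INR m / INR n).
  assert (0 < INR n) as Hn' by (apply lt_0_INR; exact Hn).
  assert (1 < q) as Hq by (apply INR_div_gt_1; assumption).
  destruct (rfun_spec q Hq) as (Hr & Hr2 & _).
  exists (knot_isotopy q). split; [|split; [|split]].
  - intros s x eps _ He. destruct (knot_isotopy_cts q Hr) as (Cx & Cy & Cz).
    destruct (cts_joint (knot_isotopy q) Cx Cy Cz s x eps He) as (d & Hd & K).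
    exists d. split; [exact Hd|]. intros. apply K; assumption.
  - intros. apply knot_isotopy_homeo; assumption.
  - apply knot_isotopy_0.
  (* The half turn changes [2 - cos th] into [2 + cos (n phi)], and the summand [q PI] of the
     untwisting angle cancels its effect on the longitude, leaving [- m phi]. *)
  - assert (forall t phi, t - 2 * phase (rfun q) t = - (INR n * phi) - PI ->
       knot_isotopy q 1 (gtilde q t) = std_torus_knot (- Z.of_nat m) (Z.of_nat n) phi) as K.
    { intros t phi E. rewrite (knot_isotopy_1 q t Hr Hr2), E. unfold std_torus_knot.
      rewrite opp_IZR, <- !INR_IZR_INZ.
      replace (q * (- (INR n * phi) - PI) + q * PI) with (- INR m * phi) by (unfold q; field; lra).
      replace (- (INR n * phi) - PI) with (- (INR n * phi + PI)) by ring.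
      rewrite cos_neg, sin_neg, neg_cos, neg_sin. f_equal; ring. }
    intros y. split.
    + intros [phi <-].
      destruct (phase_eccentric_surjective _ Hr Hr2 (- (INR n * phi) - PI)) as [t Ht].
      exists (gtilde q t). split; [exists t; reflexivity|]. apply K. exact Ht.
    + intros (x & [t <-] & <-). exists (- (t - 2 * phase (rfun q) t + PI) / INR n).
      symmetry. apply K. field. lra.
Qed.

(** A point of the curve determines [cos t] through its radius, then [sin t] through its height,
    then [e^(i q t)] through its planar part; arithmetic with [q = m / n] finishes. *)
Lemma gtilde_simple_closed (m n : nat) : (0 < n)%nat -> (n < m)%nat -> Nat.gcd m n = 1%nat ->
  simple_closed (gtilde (INR m / INR n)).
Proof.
  intros Hn Hm Hg. set (q := INR m / INR n).
  assert (0 < INR n) as Hn' by (apply lt_0_INR; exact Hn).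
  assert (1 < q) as Hq by (apply INR_div_gt_1; assumption).
  destruct (rfun_spec q Hq) as (Hr & Hr2 & _).
  pose proof PI_RGT_0 as HPI.
  assert (forall t, 4 + rfun q ^ 4 + (4 - rfun q ^ 4) * cos t <> 0) as HD
    by (intros; apply Rgt_not_eq, eta_denominator_pos; assumption).
  split.
  - intros t. unfold gtilde, rotz, eta. cbv zeta. cbn [px py pz].
    repeat split; revert t;
    match goal with |- forall t, continuity_pt ?f t => change (continuity f) end;
    apply cts_continuity; cts_tac; intros; apply HD.
  - exists (2 * PI * INR n). split; [nra|]. split.
    + intros t.
      destruct (gtilde_polar q t Hr (HD t)) as [P Pz].
      destruct (gtilde_polar q (t + 2 * PI * INR n) Hr (HD _)) as [P' Pz'].
      assert (expi (t + 2 * PI * INR n) = expi t) as E.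
      { rewrite expi_add, INR_IZR_INZ, expi_2PI_Z. ring. }
      assert (expi (q * (t + 2 * PI * INR n)) = expi (q * t)) as Eq.
      { replace (q * (t + 2 * PI * INR n)) with (q * t + 2 * PI * IZR (Z.of_nat m)).
        - rewrite expi_add, expi_2PI_Z. ring.
        - rewrite <- INR_IZR_INZ. unfold q. field. lra. }
      pose proof (f_equal re E) as Ec. pose proof (f_equal im E) as Es. simpl in Ec, Es.
      rewrite E, Eq, Ec, <- P in P'. rewrite Ec, Es, <- Pz in Pz'.
      destruct (gtilde q t) as [x y z], (gtilde q (t + 2 * PI * INR n)) as [x' y' z'].
      cbn [px py pz] in P', Pz'.
      injection P' as -> ->. rewrite Pz'. reflexivity.
    + intros s t Hs Ht E.
      pose proof (gtilde_rho2 q s Hr Hr2) as Rs. pose proof (gtilde_rho2 q t Hr Hr2) as Rt.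
      destruct (gtilde_polar q s Hr (HD s)) as [Ps Pzs].
      destruct (gtilde_polar q t Hr (HD t)) as [Pt Pzt].
      cbv zeta in Rs, Rt. rewrite E in Rs, Ps, Pzs. rewrite Rt in Rs. rewrite Pt in Ps.
      rewrite Pzt in Pzs. clear E Pt Pzt Rt.
      set (r := rfun q) in *. pose proof (HD s) as Ds. pose proof (HD t) as Dt.
      assert (0 < r ^ 2) as Hr0 by (apply pow_lt; exact Hr).
      assert (r ^ 4 < 4) as Hr4 by (replace (r ^ 4) with (r ^ 2 * r ^ 2) by ring; nra).
      assert (4 + r ^ 4 + (4 - r ^ 4) * cos s = 4 + r ^ 4 + (4 - r ^ 4) * cos t) as ED.
      { apply Rmult_eq_reg_l with (8 * r ^ 2 / (4 + r ^ 4 + (4 - r ^ 4) * cos s)).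
        - rewrite <- Rs at 2. field; split; assumption.
        - apply Rmult_integral_contrapositive. split; [lra|apply Rinv_neq_0_compat; exact Ds]. }
      assert (cos s = cos t) as Ec by nra.
      rewrite ED in Pzs.
      assert (sin s = sin t) as Es.
      { apply Rmult_eq_reg_l with ((r ^ 4 - 4) / (4 + r ^ 4 + (4 - r ^ 4) * cos t)).
        - transitivity ((r ^ 4 - 4) * sin s / (4 + r ^ 4 + (4 - r ^ 4) * cos t)); [field; exact Dt|].
          rewrite <- Pzs. field; exact Dt.
        - apply Rmult_integral_contrapositive. split; [lra|apply Rinv_neq_0_compat; exact Dt]. }
      assert (expi s = expi t) as Ee by (apply C_eq; assumption).
      rewrite ED, Ee in Ps.
      apply Cmul_cancel_l in Ps.
      2:{ apply RtoC_neq0. apply Rmult_integral_contrapositive.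
          split; [lra|apply Rinv_neq_0_compat; exact Dt]. }
      assert (expi (q * s) = expi (q * t)) as Eq.
      { symmetry.
        apply (Cmul_cancel_l (Cadd (RtoC (2 + r ^ 2)) (Cmul (RtoC (2 - r ^ 2)) (expi t)))).
        2:{ transitivity (Cmul (expi (q * t))
              (Cadd (RtoC (2 + r ^ 2)) (Cmul (RtoC (2 - r ^ 2)) (expi t)))); [ring|].
            rewrite Ps. ring. }
        intros Z. apply (f_equal re) in Z. simpl in Z.
        pose proof (phase_denominator_pos r t Hr Hr2). simpl in *. lra. }
      assert (forall x y, expi x = expi y -> exists k : Z, x - y = 2 * PI * IZR k) as G.
      { intros x y H. apply expi_eq1. unfold Rminus. rewrite expi_add, H, <- expi_add, Rplus_opp_r.
        apply expi_0. }
      destruct (G _ _ Ee) as [k Hk]. destruct (G _ _ Eq) as [j Hj].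
      assert (IZR (Z.of_nat m * k) = IZR (Z.of_nat n * j)) as EZ.
      { rewrite !mult_IZR, <- !INR_IZR_INZ. apply Rmult_eq_reg_l with (2 * PI); [|lra].
        transitivity (INR n * (2 * PI * IZR j)); [|ring]. rewrite <- Hj.
        transitivity (INR m * (2 * PI * IZR k)); [ring|]. rewrite <- Hk.
        unfold q. field. lra. }
      apply eq_IZR in EZ.
      (* From [s - t = 2 PI k] and [q (s - t) = 2 PI j] comes [m k = n j], so coprimality makes [n]
         divide [k]. *)
      assert (Nat.divide n (Z.abs_nat k)) as [i Hi].
      { apply (Nat.gauss _ m); [|rewrite Nat.gcd_comm; exact Hg].
        exists (Z.abs_nat j). apply Nat2Z.inj. rewrite !Nat2Z.inj_mul, !Zabs2Nat.id_abs.
        nia. }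
      (* Both parameters lie in one period of length [2 PI n], so [|k| < n], and the only such
         multiple of [n] is 0. *)
      assert (Rabs (2 * PI * IZR k) < 2 * PI * INR n) as Hb.
      { rewrite <- Hk. apply Rabs_def1; lra. }
      rewrite Rabs_mult, (Rabs_pos_eq (2 * PI)) in Hb by lra.
      apply Rmult_lt_reg_l in Hb; [|lra].
      rewrite <- abs_IZR, INR_IZR_INZ in Hb. apply lt_IZR in Hb.
      assert (k = 0%Z) as ->.
      { destruct i as [|i]; [lia|]. assert (Z.abs_nat k < n)%nat by lia. nia. }
      lra.
Qed.

(* Gam 0 is the normalized lift Gamma of the natural parameterization gamma = [Gam 0],
   Gam k its k-th derivative. *)
Theorem mainTheorem6 (Gam : nat -> R -> C3) (c : R) :
  smooth3 Gam ->
  (forall t, herm (Gam 0%nat t) (Gam 0%nat t) = C0) ->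
  (forall t, herm (Gam 0%nat t) (Gam 1%nat t) = C0) ->
  (forall t, det3 (Gam 0%nat t) (Gam 1%nat t) (Gam 2%nat t) = Ci) ->
  (forall t, im (herm (Gam 3%nat t) (Gam 2%nat t)) = 1) ->
  (forall t, Cmul (RtoC (1 / 2)) (herm (Gam 2%nat t) (Gam 2%nat t)) = RtoC c) ->
  (periodic_curve (Gam 0%nat) <-> exists q : Q, 1 < Q2R q /\ c = cfun (Q2R q)) /\
  (forall m n : nat, (0 < n)%nat -> (n < m)%nat -> Nat.gcd m n = 1%nat ->
     c = cfun (INR m / INR n) ->
     cr_equiv (Gam 0%nat) (fun t => p_h_inv (gtilde (INR m / INR n) t)) /\
     torus_knot_of_type (gtilde (INR m / INR n)) (- Z.of_nat m)%Z (Z.of_nat n)).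
Proof.
  intros Hs H0 H1 Hd Ha Hb.
  pose proof (mknatural_lift Gam c Hs H0 H1 Hd Ha Hb) as N.
  split; [exact (periodic_iff N)|].
  intros m n Hn Hm Hg Ec. split.
  - apply (cr_equiv_model N); [|exact Ec]. apply INR_div_gt_1; assumption.
  - split; [apply gtilde_simple_closed | apply gtilde_ambient_isotopic]; assumption.
Qed.
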